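(* Let $\alpha\le\beta$ be infinite cardinals. A Banach space $E$ is $(\alpha,\beta)_1$-injective if and only if $E$ is (isometric to) a $1$-complemented subspace of some Banach space of $(\alpha,\beta)$-universal disposition.
   Context: All Banach spaces are over the same scalar field, operators are bounded and linear, and ''into isometry'' means a linear isometric embedding, not necessarily surjective. $\operatorname{dens} X$ denotes the density character of $X$ (the least cardinality of a dense subset). By convention, ''density character $<\aleph_0$'' means finite-dimensional. For infinite cardinals $\alpha\le\beta$ and $\lambda\ge 1$, a Banach space $E$ is $(\alpha,\beta)_\lambda$-injective if for every Banach space $B$ with $\operatorname{dens} B<\beta$ and every subspace $A\subset B$ with $\operatorname{dens} A<\alpha$, every operator $t:A\to E$ can be extended to an operator $T:B\to E$ with $\|T\|\le\lambda\|t\|$. A Banach space $U$ is of $(\alpha,\beta)$-universal disposition if, given Banach spaces $A,B$ with $\operatorname{dens} A<\alpha$ and $\operatorname{dens} B<\beta$ and into isometries $u:A\to U$ and $\imath:A\to B$, there is an into isometry $u':B\to U$ such that $u=u'\imath$. A closed subspace $Y$ of a Banach space $Z$ is $1$-complemented if there is a linear projection of $Z$ onto $Y$ of norm at most $1$. *)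

(* Defs.v *)
From HB Require Import structures.
From mathcomp Require Import all_boot all_order all_algebra.
From mathcomp Require Import all_classical all_reals all_analysis.
From mathcomp Require Import complex.

Set Implicit Arguments.
Unset Strict Implicit.
Unset Printing Implicit Defensive.

Import Order.TTheory GRing.Theory Num.Theory.
Import numFieldNormedType.Exports.

Local Open Scope classical_set_scope.
Local Open Scope card_scope.
Local Open Scope ring_scope.

(* A cardinal is represented by a type having that cardinality, so that
   [infinite_set [set: a]] reads "a is an infinite cardinal" and
   [[set: a] #<= [set: b]] reads "a <= b". *)
Definition card_lt (T U : Type) (A : set T) (B : set U) : Prop :=
  (A #<= B) /\ ~ (B #<= A).

Variant scalar_kind := RealScalars | ComplexScalars.

Definition scalars (R : realType) (k : scalar_kind) : numFieldType :=
  match k with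
  | RealScalars => R
  | ComplexScalars => R[i]%C
  end.

Definition re_scalar (R : realType) (k : scalar_kind) : scalars R k -> R :=
  match k return scalars R k -> R with
  | RealScalars => fun x => x
  | ComplexScalars => fun x => complex.Re x
  end.

(* The norm of a normed module over K is K-valued (a nonnegative real element
   of K); [rnorm] is the same number as an element of R. *)
Definition rnorm (R : realType) (k : scalar_kind)
    (V : normedModType (scalars R k)) (x : V) : R :=
  re_scalar `|x|.

Section Subspace.
Variables (K : numFieldType) (V : normedModType K).

Record linear_subspace (A : submodClosed V) :=
  LinearSubspace { linear_subspace_val : V; _ : linear_subspace_val \in A }.

Variable A : submodClosed V.

HB.instance Definition _ := [isSub for @linear_subspace_val A].
HB.instance Definition _ := [Choice of linear_subspace A by <:].
HB.instance Definition _ := [SubChoice_isSubLmodule of linear_subspace A by <:].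

Definition linear_subspace_norm (x : linear_subspace A) : K := `|val x|.

Fact linear_subspace_ler_normD (x y : linear_subspace A) :
  linear_subspace_norm (x + y) <= linear_subspace_norm x + linear_subspace_norm y.
Proof. by rewrite /linear_subspace_norm raddfD ler_normD. Qed.

Fact linear_subspace_normrZ (l : K) (x : linear_subspace A) :
  linear_subspace_norm (l *: x) = `|l| * linear_subspace_norm x.
Proof. by rewrite /linear_subspace_norm linearZ normrZ. Qed.

Fact linear_subspace_norm0 (x : linear_subspace A) :
  linear_subspace_norm x = 0 -> x = 0.
Proof.
by move=> /eqP; rewrite normr_eq0 => /eqP x0; apply/val_inj; rewrite x0 raddf0.
Qed.

HB.instance Definition _ := Lmodule_isNormed.Build K (linear_subspace A)
  linear_subspace_ler_normD linear_subspace_normrZ linear_subspace_norm0.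

End Subspace.

Section Operators.
Variables (R : realType) (k : scalar_kind).
Implicit Types V W : normedModType (scalars R k).

Definition bounded_operator V W (f : {linear V -> W}) : Prop :=
  exists M : R, forall x, rnorm (f x) <= M * rnorm x.

(* Meaningful for bounded operators only: otherwise this is [inf set0 = 0]. *)
Definition opnorm V W (f : {linear V -> W}) : R :=
  inf [set M : R | 0 <= M /\ forall x, rnorm (f x) <= M * rnorm x].

(* "Into isometries": not necessarily surjective. *)
Definition into_isometry V W (f : {linear V -> W}) : Prop :=
  forall x, `|f x| = `|x|.

Definition isometric V W : Prop :=
  exists f : {linear V -> W}, into_isometry f /\ set_surj setT setT f.

Definition finite_dimensional V : Prop :=
  exists (n : nat) (e : 'I_n -> V),
    forall x : V, exists c : 'I_n -> scalars R k, x = \sum_(i < n) c i *: e i.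

(* dens V < a.  As dens V is the least cardinality of a dense subset, this says
   that some dense subset has cardinality < a; for a = aleph_0 it means, by
   convention, that V is finite-dimensional. *)
Definition dens_lt V (a : Type) : Prop :=
  if [set: a] #= [set: nat] then finite_dimensional V
  else exists2 D : set V, dense D & card_lt D [set: a].

End Operators.

Section Classes.
Variables (R : realType) (k : scalar_kind).
Local Notation banach := (completeNormedModType (scalars R k)).

Definition injective_space (a b : Type) (lambda : R) (E : banach) : Prop :=
  forall (B : banach) (A : submodClosed B),
    dens_lt B b -> dens_lt (linear_subspace A) a ->
    forall t : {linear linear_subspace A -> E}, bounded_operator t ->
    exists T : {linear B -> E},
      [/\ bounded_operator T,
          forall x : linear_subspace A, T (val x) = t x
        & opnorm T <= lambda * opnorm t].

Definition universal_disposition (a b : Type) (U : banach) : Prop :=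
  forall A B : banach, dens_lt A a -> dens_lt B b ->
  forall (u : {linear A -> U}) (i : {linear A -> B}),
    into_isometry u -> into_isometry i ->
    exists2 u' : {linear B -> U}, into_isometry u' & u =1 u' \o i.

Definition one_complemented (Z : banach) (Y : submodClosed Z) : Prop :=
  closed [set x | x \in Y] /\
  exists P : {linear Z -> Z},
    [/\ bounded_operator P, opnorm P <= 1,
        forall x, P x \in Y & forall y, y \in Y -> P y = y].

End Classes.

(* Main.v *)
Require Import Defs.
From HB Require Import structures.
From mathcomp Require Import all_boot all_order all_algebra.
From mathcomp Require Import all_classical all_reals all_analysis.
From mathcomp Require Import complex ring lra.

Set Implicit Arguments.
Unset Strict Implicit.
Unset Printing Implicit Defensive.

Import Order.TTheory GRing.Theory Num.Theory.
Import numFieldNormedType.Exports.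

Local Open Scope classical_set_scope.
Local Open Scope card_scope.
Local Open Scope ring_scope.

(** Both directions rest on one free construction.  Terms are built from a
    seminormed space [L], linear combinations, and formal solutions of extension
    problems ("new vectors whose combinations with given vectors obey prescribed
    norm bounds").  They are normed by the largest family of functionals that
    extend across every admissible problem which all of them can solve.  By
    Hahn-Banach the old functionals extend to the new vectors, so adjoining
    solutions does not change the norm; limits of Cauchy sequences and pushouts of
    isometries [A -> U], [A -> B] are such problems, so the result is a Banach
    space of universal disposition.  No transfinite iteration is needed.

    If [E] is injective, every admissible problem can also be solved inside [E];
    choosing solutions recursively gives a norm-one retraction onto [E].
    Conversely, an operator [t : A -> E] is extended through the completion of [B]
    for the pushout norm, in which the closure of [t A] sits isometrically. *)

(** Adjoining solutions stage by stage would require bookkeeping and a retraction onto [E] that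
    survives every stage. The syntax avoids this: any family in the space lifts to a family [u] of
    terms, whose solution already has the name [Node d u]. Only the norm is left to choose, and
    there is a circle: the norm must obey the conditions at solvable nodes, while solvability
    depends on the norm. A greatest consistent family breaks it, and that family turns out to be the
    whole dual unit ball. Admissible problems are those that [E] solves whenever all its contractive
    functionals see a scalar solution; completeness puts limits among them, injectivity the amalgams
    of small spaces. In the converse, [E] may have a large density, so only the closure of [t A] is
    glued to [B]. *)

Section Scalars.
Variables (R : realType) (k : scalar_kind).
Local Notation K := (scalars R k).

Definition scalar_of_real : R -> K :=
  match k return R -> scalars R k with
  | RealScalars => fun x => x
  | ComplexScalars => fun x => (x%:C)%C
  end.
Local Notation rK := scalar_of_real.
Local Notation re := (@re_scalar R k).

Lemma rKD x y : rK (x + y) = rK x + rK y.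
Proof. by rewrite /rK; case: k => //=; rewrite rmorphD. Qed.
Lemma rKM x y : rK (x * y) = rK x * rK y.
Proof. by rewrite /rK; case: k => //=; rewrite rmorphM. Qed.
Lemma rK0 : rK 0 = 0. Proof. by rewrite /rK; case: k. Qed.
Lemma rK1 : rK 1 = 1. Proof. by rewrite /rK; case: k. Qed.
Lemma rKN x : rK (- x) = - rK x.
Proof. by rewrite /rK; case: k => //=; rewrite rmorphN. Qed.
Lemma rK_le x y : (rK x <= rK y) = (x <= y).
Proof. by rewrite /rK; case: k => //=; rewrite lecR. Qed.
Lemma rK_lt x y : (rK x < rK y) = (x < y).
Proof. by rewrite /rK; case: k => //=; rewrite ltcR. Qed.
Lemma rKK x : re (rK x) = x.
Proof. by rewrite /rK /re_scalar; case: k. Qed.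

Lemma reD x y : re (x + y) = re x + re y.
Proof. by move: x y; rewrite /re_scalar; case: k => //= -[a b] [c d]. Qed.
Lemma re_rKM c z : re (rK c * z) = c * re z.
Proof.
move: c z; rewrite /rK /re_scalar; case: k => //= c [a b] /=.
by rewrite mul0r subr0.
Qed.
Lemma re0 : re 0 = 0. Proof. by rewrite -rK0 rKK. Qed.
Lemma reN x : re (- x) = - re x.
Proof. by apply/eqP; rewrite -subr_eq0 opprK -reD addNr re0. Qed.

Lemma ge0_rK (z : K) : 0 <= z -> z = rK (re z).
Proof.
move: z; rewrite /rK /re_scalar; case: k => //= -[a b]; rewrite lecE /=.
by case/andP=> /eqP -> _.
Qed.

Lemma re_ge0 (z : K) : 0 <= z -> 0 <= re z.
Proof. by move=> z0; rewrite -rK_le rK0 -ge0_rK. Qed.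

Definition modulus (z : K) : R := re `|z|.
Local Notation nK := modulus.

Lemma rK_modulus z : rK (nK z) = `|z|.
Proof. by rewrite /modulus -ge0_rK. Qed.
Lemma modulus_ge0 z : 0 <= nK z. Proof. exact: re_ge0. Qed.

Lemma rKI x y : rK x = rK y -> x = y.
Proof. by move=> /(congr1 re); rewrite !rKK. Qed.

Lemma modulusM x y : nK (x * y) = nK x * nK y.
Proof. by apply: rKI; rewrite rKM !rK_modulus normrM. Qed.
Lemma modulusN x : nK (- x) = nK x.
Proof. by apply: rKI; rewrite !rK_modulus normrN. Qed.
Lemma modulusD x y : nK (x + y) <= nK x + nK y.
Proof. by rewrite -rK_le rKD !rK_modulus ler_normD. Qed.
Lemma modulus_rK x : nK (rK x) = `|x|.
Proof.
have [x0|x0] := leP 0 x; rewrite /modulus.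
  by rewrite ger0_norm ?rKK ?ger0_norm // -rK0 rK_le.
by rewrite ltr0_norm ?reN ?rKK ?ltr0_norm // -rK0 rK_lt.
Qed.
Lemma modulus0 : nK 0 = 0. Proof. by rewrite -rK0 modulus_rK normr0. Qed.
Lemma modulus1 : nK 1 = 1. Proof. by rewrite -rK1 modulus_rK normr1. Qed.
Lemma modulus0_eq0 z : nK z = 0 -> z = 0.
Proof. by move=> z0; apply/normr0_eq0; rewrite -rK_modulus z0 rK0. Qed.

Lemma re_le_modulus z : `|re z| <= nK z.
Proof.
rewrite /modulus; move: z; rewrite /re_scalar; case: k => /= z; first exact: lexx.
by case: z => x y; have := normc_ge_Re (x +i* y)%C; rewrite normc_def /= lecR.
Qed.

Lemma modulus_rotate z : exists2 w, nK w = 1 & re (w * z) = nK z.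
Proof.
have [->|z0] := eqVneq z 0.
  by exists 1; rewrite ?modulus1 // mulr0 re0 modulus0.
have nz0 : rK (nK z) != 0 by rewrite rK_modulus normr_eq0.
exists (rK (nK z) / z); last by rewrite divfK ?rKK.
have : nK (rK (nK z) / z) * nK z = nK z.
  by rewrite -modulusM divfK // modulus_rK ger0_norm // modulus_ge0.
move/eqP; rewrite -subr_eq0 -{3}(mul1r (nK z)) -mulrBl mulf_eq0 subr_eq0.
case/orP => /eqP // zz; by rewrite zz rK0 eqxx in nz0.
Qed.

Lemma re_mul_inj (x y : K) : (forall c, re (c * x) = re (c * y)) -> x = y.
Proof.
move=> h; apply/eqP; rewrite -subr_eq0; apply/eqP; apply: modulus0_eq0.
have [w _ <-] := modulus_rotate (x - y).
by rewrite mulrBr reD reN h subrr.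
Qed.

Section RNorm.
Variable V : normedModType K.
Implicit Types x y : V.
Lemma rK_rnorm x : rK (rnorm x) = `|x|.
Proof. by rewrite /rnorm -ge0_rK. Qed.
Lemma rnorm_ge0 x : 0 <= rnorm x. Proof. exact: re_ge0. Qed.
Lemma rnormD x y : rnorm (x + y) <= rnorm x + rnorm y.
Proof. by rewrite -rK_le rKD !rK_rnorm ler_normD. Qed.
Lemma rnormZ c x : rnorm (c *: x) = nK c * rnorm x.
Proof. by apply: rKI; rewrite rKM !rK_rnorm rK_modulus normrZ. Qed.
Lemma rnormN x : rnorm (- x) = rnorm x.
Proof. by apply: rKI; rewrite !rK_rnorm normrN. Qed.
Lemma rnormB x y : rnorm (x - y) = rnorm (y - x).
Proof. by rewrite -rnormN opprB. Qed.
Lemma rnorm0 : rnorm (0 : V) = 0.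
Proof. by apply: rKI; rewrite rK_rnorm normr0 rK0. Qed.
Lemma rnorm0_eq0 x : rnorm x = 0 -> x = 0.
Proof. by move=> h; apply/normr0_eq0; rewrite -rK_rnorm h rK0. Qed.
Lemma rnormBD x y z : rnorm (x - z) <= rnorm (x - y) + rnorm (y - z).
Proof. by apply: le_trans (rnormD _ _); rewrite addrA subrK. Qed.
End RNorm.

Lemma modulusBD x y z : nK (x - z) <= nK (x - y) + nK (y - z).
Proof. by apply: le_trans (modulusD _ _); rewrite addrA subrK. Qed.
Lemma modulusB x y : nK (x - y) = nK (y - x).
Proof. by rewrite -modulusN opprB. Qed.

Definition seminorm (V : lmodType K) (p : V -> R) :=
  (forall x y, p (x + y) <= p x + p y) /\ (forall c x, p (c *: x) = nK c * p x).

Definition lin (V : lmodType K) (f : V -> K) :=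
  forall c x y, f (c *: x + y) = c * f x + f y.

Lemma seminorm_rnorm (V : normedModType K) : seminorm (@rnorm R k V).
Proof. by split; [exact: rnormD|exact: rnormZ]. Qed.

Section Seminorm.
Variables (V : lmodType K) (p : V -> R).
Hypothesis sp : seminorm p.
Lemma seminorm0 : p 0 = 0.
Proof. by rewrite -(scale0r 0) sp.2 modulus0 mul0r. Qed.
Lemma seminormN x : p (- x) = p x.
Proof. by rewrite -scaleN1r sp.2 modulusN modulus1 mul1r. Qed.
Lemma seminorm_ge0 x : 0 <= p x.
Proof. have := sp.1 x (- x); rewrite subrr seminorm0 seminormN; lra. Qed.
End Seminorm.

Lemma modulus_gt0 z : z != 0 -> 0 < nK z.
Proof.
move=> z0; rewrite lt_def modulus_ge0 andbT; apply: contra_neq z0.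
exact: modulus0_eq0.
Qed.

Lemma seminorm_of_le (V : lmodType K) (p : V -> R) :
    (forall x y, p (x + y) <= p x + p y) -> p 0 <= 0 ->
    (forall c x, c != 0 -> p (c *: x) <= nK c * p x) ->
  seminorm p.
Proof.
move=> pD p0 pZ; split=> // c x; have [->|c0] := eqVneq c 0.
  rewrite scale0r modulus0 mul0r; apply: le_anti; rewrite p0 /=.
  by have := pD 0 0; rewrite addr0; lra.
apply: le_anti; rewrite pZ //=.
have := pZ c^-1 (c *: x); rewrite invr_eq0 scalerA mulVf // scale1r => /(_ c0) h.
apply: le_trans (ler_wpM2l (modulus_ge0 c) h) _.
by rewrite mulrA -modulusM mulfV // modulus1 mul1r.
Qed.

Section Lin.
Variables (V : lmodType K) (f : V -> K).
Hypothesis lf : lin f.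
Lemma lin0 : f 0 = 0.
Proof. by have := lf (-1) 0 0; rewrite scaler0 addr0 mulN1r addNr. Qed.
Lemma linD x y : f (x + y) = f x + f y.
Proof. by have := lf 1 x y; rewrite scale1r mul1r. Qed.
Lemma linZ c x : f (c *: x) = c * f x.
Proof. by have := lf c x 0; rewrite !addr0 lin0 addr0. Qed.
Lemma linN x : f (- x) = - f x.
Proof. by rewrite -scaleN1r linZ mulN1r. Qed.
Lemma linB x y : f (x - y) = f x - f y.
Proof. by rewrite linD linN. Qed.
End Lin.

Lemma scalars_cases : (forall z, z = rK (re z)) \/
  exists (i : K) (im : K -> R),
    [/\ i * i = -1, forall z, z = rK (re z) + rK (im z) * i & re i = 0].
Proof.
rewrite /rK /re_scalar; case: k => /=; first by left.
right; exists 'i%C, (@complex.Im R); split=> //.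
  by rewrite -expr2; exact: sqr_i.
by case=> a b; apply/eqP; rewrite eq_complex /=; simpc.
Qed.

(** In the complex case [phi] is the real part of [phi x - i phi (i x)], which is complex linear.
    The modulus bound follows by rotating [f x] onto the positive axis and moving the rotation into
    [x], where [p] does not notice it. *)
Lemma complexify (V : lmodType K) (p phi : V -> R) :
    seminorm p -> (forall x y, phi (x + y) = phi x + phi y) ->
    (forall c x, phi (rK c *: x) = c * phi x) -> (forall x, phi x <= p x) ->
  exists f : V -> K, [/\ lin f, forall x, re (f x) = phi x &
    forall x, nK (f x) <= p x].
Proof.
move=> sp phiD phiZ phip.
suff [f [lf fre]] : exists f : V -> K, lin f /\ forall x, re (f x) = phi x.
  exists f; split=> // x; have [w w1 <-] := modulus_rotate (f x).
  by rewrite -(linZ lf) fre (le_trans (phip _)) // sp.2 w1 mul1r.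
have phiN x : phi (- x) = - phi x.
  by have := phiZ (-1) x; rewrite rKN rK1 scaleN1r mulN1r.
case: scalars_cases => [reK|[i [im [sqi imE rei]]]].
  exists (fun x => rK (phi x)); split=> [c x y|x]; last by rewrite rKK.
  by rewrite phiD (reK c) phiZ rKD rKM.
exists (fun x => rK (phi x) - rK (phi (i *: x)) * i); split=> [c x y|x]; last first.
  by rewrite reD reN re_rKM rei mulr0 subr0 rKK.
have swap a z : i *: (rK a *: z) = rK a *: (i *: z) by rewrite !scalerA mulrC.
have -> : c *: x = rK (re c) *: x + rK (im c) *: (i *: x).
  by rewrite scalerA -scalerDl -imE.
rewrite !scalerDr !phiD !swap [i *: (i *: _)]scalerA sqi scaleN1r !phiZ phiN.
rewrite !(rKD, rKM, rKN) [in RHS](imE c); apply/eqP; rewrite -subr_eq0; apply/eqP.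
transitivity (rK (im c) * rK (phi (i *: x)) * (1 + i * i)); first by ring.
by rewrite sqi subrr mulr0.
Qed.

End Scalars.

(** * The Hahn-Banach theorem for seminorms *)

Section HahnBanach.
Variables (R : realType) (k : scalar_kind).
Local Notation K := (scalars R k).
Local Notation rK := (@scalar_of_real R k).
Local Notation re := (@re_scalar R k).
Local Notation nK := (@modulus R k).
Variable V : lmodType K.

Definition sublinear (p : V -> R) :=
  (forall x y, p (x + y) <= p x + p y) /\
  (forall c x, 0 < c -> p (rK c *: x) <= c * p x).

Lemma rK_unitr c : c != 0 -> rK c^-1 * rK c = 1.
Proof. by move=> c0; rewrite -rKM mulVf // rK1. Qed.

Lemma sublinearZ p c x : sublinear p -> 0 < c -> p (rK c *: x) = c * p x.
Proof.
move=> [_ pZ] c0; apply: le_anti; rewrite pZ //=.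
have := pZ c^-1 (rK c *: x); rewrite invr_gt0 => /(_ c0).
rewrite scalerA rK_unitr ?gt_eqF // scale1r => h.
by rewrite mulrC -ler_pdivlMr // mulrC.
Qed.

Lemma sublinear0 p : sublinear p -> p 0 = 0.
Proof.
move=> sp; have := sublinearZ 0 sp (ltr0n R 2); rewrite scaler0 => h.
lra.
Qed.

Lemma sublinearN p x : sublinear p -> - p (- x) <= p x.
Proof. move=> sp; have := sp.1 x (- x); rewrite subrr sublinear0 //; lra. Qed.

Section Minimal.
Variable p1 : V -> R.
Hypothesis sp1 : sublinear p1.

Let subl := {p : V -> R | sublinear p /\ forall x, p x <= p1 x}.

(** Zorn's lemma for the reversed pointwise order, in which a chain is bounded by its pointwise
    infimum. Minimal sublinear functionals take the place of maximal partial extensions. *)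
Lemma minimal_sublinear : exists p, [/\ sublinear p, forall x, p x <= p1 x &
  forall q, sublinear q -> (forall x, q x <= p x) -> q =1 p].
Proof.
pose top : subl := exist _ p1 (conj sp1 (fun x => lexx (p1 x))).
have [||||[p [sp pp1]] pmin] :=
    @Zorn subl (fun p q => `[<forall x, sval q x <= sval p x>]).
- by move=> t; apply/asboolP => x; exact: lexx.
- move=> r s t /asboolP rs /asboolP st; apply/asboolP => x.
  exact: le_trans (st x) (rs x).
- move=> s t /asboolP st /asboolP ts; have e : sval s = sval t.
    by apply/funext => x; apply: le_anti; rewrite st ts.
  case: s t e {st ts} => [s hs] [t ht] /= e; case: t / e ht => ht.
  by congr exist; exact: Prop_irrelevance.
- move=> A tot; have [[q0 Aq0]|A0] := pselect (exists q, A q); last first.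
    by exists top => s As; case: A0; exists s.
  pose S x := [set r | exists2 q : subl, A q & r = sval q x].
  have S0 x : S x !=set0 by exists (sval q0 x), q0.
  (* A sublinear [q <= p1] has [q x >= - q (- x) >= - p1 (- x)], so the infimum over the chain is
     finite. *)
  have lbS x : lbound (S x) (- p1 (- x)).
    move=> _ [[q [sq qp1]] Aq ->] /=.
    by apply: le_trans (sublinearN _ sq); rewrite lerN2.
  pose m x := inf (S x).
  have mle q x : A q -> m x <= sval q x.
    by move=> Aq; apply: ge_inf; [exists (- p1 (- x)) => r /lbS|exists q].
  have lem r x : (forall q, A q -> r <= sval q x) -> r <= m x.
    by move=> h; apply: lb_le_inf => // _ [q Aq ->]; exact: h.
  have sm : sublinear m.
    split=> [x y|c x c0].
      have step q1 q2 : A q1 -> A q2 -> m (x + y) <= sval q1 x + sval q2 y.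
        move=> A1 A2; case: (tot _ _ A1 A2) => /asboolP h.
          apply: le_trans (mle q2 _ A2) _; apply: le_trans ((svalP q2).1.1 _ _) _.
          by rewrite lerD2r.
        apply: le_trans (mle q1 _ A1) _; apply: le_trans ((svalP q1).1.1 _ _) _.
        by rewrite lerD2l.
      rewrite -lerBlDr; apply/lem => q1 A1.
      rewrite lerBlDr -lerBlDl; apply/lem => q2 A2.
      by rewrite lerBlDl step.
    rewrite mulrC -ler_pdivrMr //; apply/lem => q Aq.
    rewrite ler_pdivrMr // mulrC.
    by apply: le_trans (mle q _ Aq) _; apply: (svalP q).1.2.
  have mp1 x : m x <= p1 x.
    by apply: le_trans (mle q0 _ Aq0) _; exact: (svalP q0).2.
  by exists (exist _ m (conj sm mp1)) => s As; apply/asboolP => x /=; exact: mle.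
exists p; split=> // q sq qp.
have qp1 x : q x <= p1 x by exact: le_trans (qp x) (pp1 x).
have := pmin (exist _ q (conj sq qp1)) (asboolT qp).
by move/(congr1 sval) => /= -> x.
Qed.

(* Minimality is tested against [y |-> inf_(t >= 0) (p (y + t x) - t p x)]. *)
Lemma minimal_sublinear_additive p : sublinear p ->
    (forall q, sublinear q -> (forall x, q x <= p x) -> q =1 p) ->
  forall x y, p (x + y) = p x + p y.
Proof.
move=> sp pmin x y; apply: le_anti; rewrite sp.1 /=.
pose S y := [set r | exists2 t, 0 <= t & r = p (y + rK t *: x) - t * p x].
have pZ t z : 0 <= t -> p (rK t *: z) = t * p z.
  rewrite le_eqVlt => /predU1P[<-|]; last exact: sublinearZ.
  by rewrite rK0 scale0r mul0r sublinear0.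
have lbS z : lbound (S z) (- p (- z)).
  move=> _ [t t0 ->]; rewrite -(pZ t) //.
  have := sp.1 (z + rK t *: x) (- z).
  rewrite addrAC subrr add0r; lra.
have S0 z : S z !=set0 by exists (p (z + rK 0 *: x) - 0 * p x), 0.
pose q z := inf (S z).
have qle z t : 0 <= t -> q z <= p (z + rK t *: x) - t * p x.
  by move=> t0; apply: ge_inf; [exists (- p (- z)) => r /lbS|exists t].
have leq r z : (forall t, 0 <= t -> r <= p (z + rK t *: x) - t * p x) -> r <= q z.
  by move=> h; apply: lb_le_inf => // _ [t t0 ->]; exact: h.
have sq : sublinear q.
  split=> [z w|c z c0].
    rewrite -lerBlDr; apply/leq => t t0.
    rewrite lerBlDr -lerBlDl; apply/leq => s s0.
    rewrite lerBlDl; apply: le_trans (qle _ (t + s) _) _; first exact: addr_ge0.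
    have := sp.1 (z + rK t *: x) (w + rK s *: x).
    rewrite addrACA -scalerDl -rKD; lra.
  rewrite mulrC -ler_pdivrMr //; apply/leq => t t0.
  rewrite ler_pdivrMr // mulrC.
  apply: le_trans (qle _ (c * t) _) _; first by rewrite mulr_ge0 // ltW.
  rewrite mulrBr mulrA lerD2r -(sublinearZ _ sp c0).
  by rewrite scalerDr scalerA rKM.
have qp z : q z <= p z.
  by have := qle z 0 (lexx 0); rewrite rK0 scale0r addr0 mul0r subr0.
have := qle y 1 ler01; rewrite (pmin _ sq qp) rK1 scale1r mul1r.
by rewrite lerBrDr [y + x]addrC [p y + _]addrC.
Qed.

End Minimal.

Lemma dominated_functional (p : V -> R) (p1 : V -> R) :
    seminorm p -> sublinear p1 -> (forall x, p1 x <= p x) ->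
  exists f, [/\ lin f, forall x, nK (f x) <= p x & forall x, re (f x) <= p1 x].
Proof.
move=> sp sp1 p1p; have [phi [sphi phip1 phimin]] := minimal_sublinear sp1.
have phiD := minimal_sublinear_additive sphi phimin.
have phiN x : phi (- x) = - phi x.
  have := phiD x (- x); rewrite subrr sublinear0 //; lra.
have phiZ c x : phi (rK c *: x) = c * phi x.
  case: (ltgtP c 0) => [c0|c0|->]; last by rewrite rK0 scale0r mul0r sublinear0.
    have nc0 : 0 < - c by rewrite oppr_gt0.
    have := sublinearZ x sphi nc0.
    rewrite rKN scaleNr phiN mulNr; exact: oppr_inj.
  exact: sublinearZ.
have phip x : phi x <= p x by exact: le_trans (phip1 x) (p1p x).
have [f [lf fre fp]] := complexify sp phiD phiZ phip.
by exists f; split=> // x; rewrite fre.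
Qed.

(** [S] is the graph of the functional to be extended; the bound by [p] makes it single-valued. The
    infimum [p1] below is the largest sublinear minorant of [p] with [p1 z <= re a] on [S]. As [S]
    is linear, applying this inequality to all scalar multiples gives equality of scalars. *)
Theorem hahn_banach_rel (p : V -> R) (S : V -> K -> Prop) :
    seminorm p -> S 0 0 ->
    (forall c x y a b, S x a -> S y b -> S (c *: x + y) (c * a + b)) ->
    (forall x a, S x a -> nK a <= p x) ->
  exists f, [/\ lin f, forall x, nK (f x) <= p x & forall x a, S x a -> f x = a].
Proof.
move=> sp S0 Slin Sp.
pose G x := [set r | exists z a, S z a /\ r = p (x - z) + re a].
have G0 x : G x !=set0 by exists (p (x - 0) + re 0), 0, 0.
have lbG x : lbound (G x) (- p x).
  move=> _ [z [a [Sza ->]]]; have h := Sp _ _ Sza.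
  have h2 := re_le_modulus a; have h3 := sp.1 (x - z) (- x).
  rewrite addrAC subrr add0r !(seminormN sp) in h3.
  move: h2; rewrite ler_norml => /andP[h2 _]; lra.
pose p1 x := inf (G x).
have p1le x z a : S z a -> p1 x <= p (x - z) + re a.
  by move=> Sza; apply: ge_inf; [exists (- p x) => r /lbG|exists z, a].
have lep1 r x : (forall z a, S z a -> r <= p (x - z) + re a) -> r <= p1 x.
  by move=> h; apply: lb_le_inf => // _ [z [a [Sza ->]]]; exact: h.
have sp1 : sublinear p1.
  split=> [x y|c x c0].
    rewrite -lerBlDr; apply/lep1 => z a Sza.
    rewrite lerBlDr -lerBlDl; apply/lep1 => w b Swb.
    rewrite lerBlDl; have := Slin 1 _ _ _ _ Sza Swb.
    rewrite scale1r mul1r => /(p1le (x + y)) h; apply: le_trans h _.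
    have := sp.1 (x - z) (y - w); rewrite addrACA -opprD reD; lra.
  rewrite mulrC -ler_pdivrMr //; apply/lep1 => z a Sza.
  rewrite ler_pdivrMr //; have := Slin (rK c) _ _ _ _ Sza S0.
  rewrite !addr0 => /(p1le (rK c *: x)) h; apply: le_trans h _.
  by rewrite -scalerBr sp.2 modulus_rK gtr0_norm // re_rKM mulrC [c * re a]mulrC -mulrDl.
have p1p x : p1 x <= p x by have := p1le x _ _ S0; rewrite subr0 re0 addr0.
have [f [lf fp fp1]] := dominated_functional sp sp1 p1p.
exists f; split=> // x a Sxa.
have fS z b : S z b -> re (f z) <= re b.
  move=> Szb; apply: le_trans (fp1 z) _; apply: le_trans (p1le z _ _ Szb) _.
  by rewrite subrr seminorm0 // add0r.
apply: re_mul_inj => c.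
have SZ d : S (d *: x) (d * a).
  by have := Slin d _ _ _ _ Sxa S0; rewrite !addr0.
apply: le_anti; rewrite -(linZ lf) fS //=.
have := fS _ _ (SZ (- c)); rewrite scaleNr (linN lf) mulNr !reN; lra.
Qed.

Corollary norming_functional (p : V -> R) (x : V) : seminorm p ->
  exists f, [/\ lin f, forall y, nK (f y) <= p y & nK (f x) = p x].
Proof.
move=> sp.
have [p0|px0] := eqVneq (p x) 0.
  exists (fun=> 0); split=> [c y z|y|]; rewrite ?modulus0 ?p0 //.
    by rewrite mulr0 addr0.
  exact: seminorm_ge0.
pose S y a := exists c : K, y = c *: x /\ a = c * rK (p x).
have nS y a : S y a -> nK a <= p y.
  move=> [c [-> ->]]; rewrite sp.2 modulusM modulus_rK ger0_norm //.
  exact: seminorm_ge0.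
have [||f [lf fp fS]] := hahn_banach_rel sp _ _ nS.
- by exists 0; rewrite scale0r mul0r.
- move=> c y z a b [d [-> ->]] [e [-> ->]]; exists (c * d + e).
  by rewrite scalerDl scalerA mulrDl mulrA.
exists f; split=> //; rewrite (fS x (rK (p x))).
  by rewrite modulus_rK ger0_norm //; exact: seminorm_ge0.
by exists 1; rewrite scale1r mul1r.
Qed.

End HahnBanach.

(** * Terms and the largest consistent family of functionals *)

Section Terms.
Variables (R : realType) (k : scalar_kind).
Local Notation K := (scalars R k).
Local Notation nK := (@modulus R k).
Variables (L : lmodType K) (J : Type).

(* An extension problem: [inl] indexes the given vectors, [inr] the new ones, and
   [datum_cond d s r] asks that the combination [s] of both has norm [<= r]. *)
Record datum := Datum {
  datum_cond : seq (K * (J + J)) -> R -> Prop;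
  datum_bound : J -> R }.

Definition comb (V : lmodType K) (v1 v2 : J -> V) (s : seq (K * (J + J))) : V :=
  \sum_(p <- s) p.1 *: (match p.2 with inl i => v1 i | inr i => v2 i end).

(** The absolute value makes every bound non-negative, so the zero family respects the bounds and
    serves as default where a problem has no solution. A bound on each unknown keeps the norm of
    terms finite. *)
Definition holds (V : lmodType K) (p : V -> R) (d : datum) (v1 v2 : J -> V) :=
  (forall s r, datum_cond d s r -> p (comb v1 v2 s) <= r) /\
  (forall j, p (v2 j) <= `|datum_bound d j|).

Local Notation Kholds := (@holds K^o nK).

Lemma comb_morph (V W : lmodType K) (f : V -> W) v1 v2 s :
    (forall c x y, f (c *: x + y) = c *: f x + f y) ->
  f (comb v1 v2 s) = comb (f \o v1) (f \o v2) s.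
Proof.
move=> lf; rewrite /comb; elim: s => [|p s IH].
  have := lf (-1) 0 0; rewrite !big_nil scaler0 addr0 => ->.
  by rewrite scaleN1r addNr.
by rewrite !big_cons lf IH; case: p.2.
Qed.

Inductive term :=
| Base of L
| Comb of K & term & term
| Node of datum & (J -> term) & J.

(** [F] sees the syntactic family [u] besides its values, because [modify_functional] must recognise
    one particular node. *)
Fixpoint teval (V : lmodType K) (f0 : L -> V)
    (F : datum -> (J -> term) -> (J -> V) -> J -> V) (t : term) : V :=
  match t with
  | Base x => f0 x
  | Comb c s t => c *: teval f0 F s + teval f0 F t
  | Node d u j => F d u (fun i => teval f0 F (u i)) j
  end.

(** The strict subterm relation. Its irreflexivity says that a node does not occur inside its own
    inputs, so its values can be changed without disturbing them. *)
Fixpoint below (s t : term) : Prop :=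
  match t with
  | Base _ => False
  | Comb _ a b => [\/ s = a, below s a, s = b | below s b]
  | Node _ u _ => exists i, s = u i \/ below s (u i)
  end.

Lemma below_trans r s t : below r s -> below s t -> below r t.
Proof.
elim: t => [//|c a IHa b IHb|d u IH j] /= rs.
  case=> [e|sa|e|sb].
  - by apply: Or42; rewrite -e.
  - by apply: Or42; exact: IHa.
  - by apply: Or44; rewrite -e.
  - by apply: Or44; exact: IHb.
case=> i [e|si]; exists i; right; first by rewrite -e.
exact: IH.
Qed.

Lemma below_irr t : ~ below t t.
Proof.
elim: t => [x []|c a IHa b IHb|d u IH j].
  have ba : below a (Comb c a b) by apply: Or41.
  have bb : below b (Comb c a b) by apply: Or43.
  move: ba bb; set t := Comb c a b => ba bb.
  case; rewrite -/t => h.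
  - by apply: IHa; rewrite -{2}h.
  - by apply: IHa; exact: below_trans ba h.
  - by apply: IHb; rewrite -{2}h.
  - by apply: IHb; exact: below_trans bb h.
case=> i h; apply: (IH i).
have : below (u i) (Node d u j) by exists i; left.
by case: h => [<- //|h bi]; exact: below_trans bi h.
Qed.

Variables (rho : L -> R) (adm : datum -> Prop).
Hypothesis srho : seminorm rho.

Definition regular (g : term -> K) :=
  [/\ forall c s t, g (Comb c s t) = c * g s + g t,
      lin (g \o Base), forall x, nK (g (Base x)) <= rho x &
      forall d u j, nK (g (Node d u j)) <= `|datum_bound d j|].

Definition solvable (D : set (term -> K)) d (u : J -> term) :=
  forall g, D g -> exists v, Kholds d (g \o u) v.

Definition consistent (D : set (term -> K)) :=
  (forall g, D g -> regular g) /\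
  forall d u, adm d -> solvable D d u ->
    forall g, D g -> Kholds d (g \o u) (g \o Node d u).

(* The larger the family [D], the fewer nodes are solvable, so that the
   consistent families are stable under union. *)
Definition functional : set (term -> K) :=
  [set g | exists2 D, consistent D & D g].

Lemma consistent_functional : consistent functional.
Proof.
split=> [g [D [Dr _] Dg]|d u ad sol g [D cD Dg]]; first exact: Dr.
apply: cD.2 => // h Dh; apply: sol; by exists D.
Qed.

(** A coinduction principle. Adjoining [g] to the largest family can only make fewer problems
    solvable, and those that stay solvable are solvable for [g], so the hypothesis makes the
    enlarged family consistent. *)
Lemma functionalP g : regular g ->
    (forall d u, adm d -> solvable functional d u ->
      (exists v, Kholds d (g \o u) v) -> Kholds d (g \o u) (g \o Node d u)) ->
  functional g.
Proof.
move=> rg hg; exists (functional `|` [set g]); last by right.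
split=> [h [/consistent_functional.1 //|->//]|d u ad sol h].
have sol' : solvable functional d u by move=> h' h'D; apply: sol; left.
case=> [hD|->]; first exact: (consistent_functional.2 _ _ ad sol' _ hD).
by apply: hg => //; apply: sol; right.
Qed.

Lemma teval_functional (f0 : L -> K^o) F : lin (f0 : L -> K) ->
    (forall x, nK (f0 x) <= rho x) ->
    (forall d u w j, nK (F d u w j) <= `|datum_bound d j|) ->
    (forall d u w, adm d -> solvable functional d u ->
      (exists v, Kholds d w v) -> Kholds d w (F d u w)) ->
  functional (teval f0 F : term -> K).
Proof.
move=> lf0 f0rho Fb FS; apply: functionalP.
  by split=> //= d u j; exact: Fb.
move=> d u ad sol ex; exact: FS.
Qed.

Definition solve (d : datum) (w : J -> K) : J -> K :=
  xget (fun=> 0) [set v | Kholds d w v].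

Lemma solveP d w : (exists v, Kholds d w v) -> Kholds d w (solve d w).
Proof. by case=> v hv; exact: (xgetI _ hv). Qed.

Lemma solve_bound d w j : nK (solve d w j) <= `|datum_bound d j|.
Proof.
rewrite /solve; case: xgetP => [v _ []//|_] /=.
by rewrite modulus0 normr_ge0.
Qed.

Lemma functional_set0 : functional !=set0.
Proof.
exists (@teval K^o (fun=> 0) (fun d _ w => solve d w)).
apply: teval_functional => [c x y|x|d u w j|d u w _ _].
- by rewrite mulr0 addr0.
- by rewrite modulus0; exact: seminorm_ge0.
- exact: solve_bound.
- exact: solveP.
Qed.

(** The freedom left by consistency: a solvable problem may be given any of its scalar solutions. As
    data impose only upper bounds, this is the source of the lower bounds on norms. *)
Lemma modify_functional g d0 u0 h : functional g -> adm d0 ->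
    solvable functional d0 u0 -> Kholds d0 (g \o u0) h ->
  exists g', [/\ functional g', g' \o u0 = g \o u0 & g' \o Node d0 u0 = h].
Proof.
move=> Dg ad0 sol0 h0; have [gC gB gr gN] := consistent_functional.1 _ Dg.
(* The prescribed value at the chosen node; the old value of [g] where the inputs evaluate as under
   [g]; a fresh solution elsewhere, since nodes above the chosen one may see new inputs. *)
pose F d u w := if `[< [/\ d = d0, u = u0 & w = g \o u0] >] then h else
  if `[< w = g \o u >] then g \o Node d u else solve d w.
pose g' : term -> K := @teval K^o (g \o Base) F.
(* A term in which [Node d0 u0] occurs has every [u0 i] as a strict subterm; a term that misses one
   of them keeps its value. *)
have agree t : ~ (forall i, below (u0 i) t) -> g' t = g t.
  elim: t => [//|c s IHs t IHt|d u IH j] /= nb.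
    rewrite gC -IHs -?IHt // => b; apply: nb => i; [exact: Or44|exact: Or42].
  have e : g' \o u = g \o u.
    apply/funext => i; apply: IH => b; apply: nb => i'.
    by exists i; right.
  rewrite -[LHS]/(F d u (g' \o u) j) e /F.
  case: asboolP => [[_ eu _]|_]; last by case: asboolP.
  by case: nb => i; exists i; left; rewrite eu.
have e0 : g' \o u0 = g \o u0.
  by apply/funext => i; apply: agree => /(_ i); exact: below_irr.
exists g'; split=> //; last first.
  apply/funext => j; rewrite -[LHS]/(F d0 u0 (g' \o u0) j) e0 /F.
  by case: asboolP => // [[]].
apply: teval_functional => // [d u w j|d u w ad sol ex].
  rewrite /F; case: asboolP => [[-> _ _]|_]; first exact: h0.2.
  by case: asboolP => _; [exact: gN|exact: solve_bound].
rewrite /F; case: asboolP => [[-> _ ->] //|_].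
case: asboolP => [->|_]; last exact: solveP.
exact: consistent_functional.2.
Qed.

Fixpoint term_bound (t : term) : R :=
  match t with
  | Base x => rho x
  | Comb c s t => nK c * term_bound s + term_bound t
  | Node d _ j => `|datum_bound d j|
  end.

Lemma functional_le_bound g t : functional g -> nK (g t) <= term_bound t.
Proof.
move=> /consistent_functional.1 [gC gB gr gN].
elim: t => [x|c s IHs t IHt|d u IH j] /=; [exact: gr| |exact: gN].
rewrite gC; apply: le_trans (modulusD _ _) _; rewrite modulusM lerD //.
by rewrite ler_wpM2l // modulus_ge0.
Qed.

Definition tnorm t := sup [set nK (g t) | g in functional].

Lemma le_tnorm g t : functional g -> nK (g t) <= tnorm t.
Proof.
move=> Dg; apply: ub_le_sup; last by exists g.
by exists (term_bound t) => _ [h Dh <-]; exact: functional_le_bound.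
Qed.

Lemma tnorm_le t r : (forall g, functional g -> nK (g t) <= r) -> tnorm t <= r.
Proof.
move=> h; apply: ge_sup => [|_ [g Dg <-]]; last exact: h.
by have [g Dg] := functional_set0; exists (nK (g t)), g.
Qed.

Definition tcomb (u v : J -> term) (s : seq (K * (J + J))) : term :=
  foldr (fun p t => Comb p.1 (match p.2 with inl i => u i | inr i => v i end) t)
    (Base 0) s.

Lemma eval_tcomb (f : term -> K) u v s :
    (forall c s t, f (Comb c s t) = c * f s + f t) -> f (Base 0) = 0 ->
  f (tcomb u v s) = @comb K^o (f \o u) (f \o v) s.
Proof.
move=> fC f0; rewrite /comb; elim: s => [|p s IH] /=; first by rewrite big_nil.
by rewrite big_cons fC IH; case: p.2.
Qed.

Lemma regular_Base0 f : regular f -> f (Base 0) = 0.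
Proof. by move=> [_ fB _ _]; exact: (lin0 fB). Qed.

(** A bipolar argument: what consistency asks of a functional additive on [Comb] are upper bounds on
    moduli of terms, linearity on the base being a bound by 0. The whole family satisfies them, so
    they are bounds on [tnorm] and pass to every [f] that it dominates. *)
Lemma tnorm_functional (f : term -> K) :
    (forall c s t, f (Comb c s t) = c * f s + f t) ->
    (forall t, nK (f t) <= tnorm t) -> functional f.
Proof.
move=> fC fle.
have fB : lin (f \o Base).
  move=> c x y /=; apply/eqP; rewrite -subr_eq0 opprD addrA; apply/eqP.
  (* The term for [f (c *: x + y) - c * f x - f y]: the whole family vanishes on it. *)
  have := fle (Comb (-1) (Base y) (Comb (- c) (Base x) (Base (c *: x + y)))).
  set t := Comb _ _ _; have -> : tnorm t = 0.
    apply: le_anti; apply/andP; split.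
      apply: tnorm_le => g /consistent_functional.1 [gC gB _ _].
      have e : g (Base (c *: x + y)) = c * g (Base x) + g (Base y) by exact: gB.
      rewrite !gC e [X in nK X](_ : _ = 0) ?modulus0 //; ring.
    have [g Dg] := functional_set0.
    exact: le_trans (modulus_ge0 _) (le_tnorm t Dg).
  rewrite !fC => h.
  have /modulus0_eq0 :
      nK (-1 * f (Base y) + (- c * f (Base x) + f (Base (c *: x + y)))) = 0.
    by apply: le_anti; rewrite h modulus_ge0.
  by move=> <-; ring.
have fr : regular f.
  split=> [//|//|x|d u j]; apply: le_trans (fle _) _; apply: tnorm_le => g.
    by move=> /consistent_functional.1 [_ _ gr _]; exact: gr.
  by move=> /consistent_functional.1 [_ _ _ gN]; exact: gN.
apply: functionalP => // d u ad sol _; split=> [s r sr|j].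
  2: by have [_ _ _ fN] := fr; exact: fN.
have <- := eval_tcomb u (Node d u) s fC (regular_Base0 fr).
apply: le_trans (fle _) _; apply: tnorm_le => g Dg.
have gr := consistent_functional.1 _ Dg.
rewrite eval_tcomb ?regular_Base0 //; last by case: gr.
exact: (consistent_functional.2 _ _ ad sol _ Dg).1.
Qed.

End Terms.

(** * The normed space of terms *)

Section SubmodOfSet.
Variables (K : numFieldType) (V : lmodType K) (S : set V).
Definition subspace_axiom :=
  S 0 /\ forall c x y, S x -> S y -> S (c *: x + y).
Definition subspace_pred of subspace_axiom : {pred V} := fun x => `[< S x >].
Variable hS : subspace_axiom.
Fact subspace_pred_submod : submod_closed (subspace_pred hS).
Proof.
split; first by apply/asboolP; exact: hS.1.
by move=> c x y /asboolP Sx /asboolP Sy; apply/asboolP; exact: hS.2.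
Qed.
HB.instance Definition _ := GRing.isSubmodClosed.Build K V (subspace_pred hS)
  subspace_pred_submod.
Definition submod_of : submodClosed V := subspace_pred hS.
End SubmodOfSet.

Section USpace.
Variables (R : realType) (k : scalar_kind).
Local Notation K := (scalars R k).
Local Notation rK := (@scalar_of_real R k).
Local Notation nK := (@modulus R k).
Variables (L : lmodType K) (J : Type) (rho : L -> R).
Variable adm : datum R k J -> Prop.
Local Notation term := (term L J).
Local Notation fdual := {g : term -> K | functional rho adm g}.

(** Realising terms as functions on the family identifies those that no functional separates, and
    supplies the linear structure of the quotient. *)
Definition eval_term (t : term) : fdual -> K^o := fun g => sval g t.

Lemma eval_term_subspace : subspace_axiom (range eval_term).
Proof.
split.
  exists (Base J 0) => //; apply/funext => -[g Dg]; rewrite /eval_term /=.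
  exact: regular_Base0 ((consistent_functional rho adm).1 g Dg).
move=> c _ _ [s _ <-] [t _ <-]; exists (Comb c s t) => //.
apply/funext => -[g Dg]; rewrite /eval_term /=.
by have [gC _ _ _] := (consistent_functional rho adm).1 _ Dg; rewrite gC.
Qed.

Local Notation range_submod := (submod_of eval_term_subspace).

Record uspace (srho : seminorm rho) :=
  USpace { ufun : fdual -> K^o; _ : ufun \in range_submod }.

Variable srho : seminorm rho.
Local Notation U := (uspace srho).

HB.instance Definition _ := [isSub for @ufun srho].
HB.instance Definition _ := [Choice of U by <:].
HB.instance Definition _ := [SubChoice_isSubLmodule of U by <:].

Fact uclass_subproof (t : term) : eval_term t \in range_submod.
Proof. by apply/asboolP; exists t. Qed.
Definition uclass (t : term) : U := USpace srho (uclass_subproof t).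

Lemma uclass_surj (x : U) : exists t, x = uclass t.
Proof.
case: x => F hF; have /asboolP [t _ e] := hF; exists t.
by apply: val_inj; rewrite /= e.
Qed.

Definition unorm (x : U) : R := sup [set nK (ufun x g) | g in setT].

Lemma unorm_uclass t : unorm (uclass t) = tnorm rho adm t.
Proof.
congr sup; apply/seteqP; split=> r.
  by case=> -[g Dg] _ <-; exists g.
by case=> g Dg <-; exists (exist _ g Dg).
Qed.

Lemma le_unorm (x : U) g : nK (ufun x g) <= unorm x.
Proof.
have [t ->] := uclass_surj x; rewrite unorm_uclass; case: g => g Dg.
exact: le_tnorm.
Qed.

Lemma unorm_le (x : U) r : (forall g, nK (ufun x g) <= r) -> unorm x <= r.
Proof.
have [t ->] := uclass_surj x => h; rewrite unorm_uclass; apply: tnorm_le => // g Dg.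
exact: (h (exist _ g Dg)).
Qed.

Lemma ufun_lin c (x y : U) g : ufun (c *: x + y) g = c * ufun x g + ufun y g.
Proof. by []. Qed.
Lemma ufunD (x y : U) g : ufun (x + y) g = ufun x g + ufun y g.
Proof. by []. Qed.
Lemma ufunZ c (x : U) g : ufun (c *: x) g = c * ufun x g.
Proof. by []. Qed.

Lemma seminorm_unorm : seminorm unorm.
Proof.
apply: seminorm_of_le => [x y||c x _]; apply: unorm_le => g.
- by rewrite ufunD (le_trans (modulusD _ _)) // lerD // le_unorm.
- by rewrite modulus0.
- by rewrite ufunZ modulusM ler_wpM2l ?modulus_ge0 // le_unorm.
Qed.

Definition unormK (x : U) : K := rK (unorm x).

Fact unormK_D (x y : U) : unormK (x + y) <= unormK x + unormK y.
Proof. by rewrite /unormK -rKD rK_le; exact: seminorm_unorm.1. Qed.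
Fact unormK_Z (c : K) (x : U) : unormK (c *: x) = `|c| * unormK x.
Proof. by rewrite /unormK seminorm_unorm.2 rKM rK_modulus. Qed.
Fact unormK_0 (x : U) : unormK x = 0 -> x = 0.
Proof.
rewrite /unormK -(rK0 R k) => /rKI x0; apply: val_inj; apply/funext => g.
apply: (@modulus0_eq0 R k); apply: le_anti; rewrite modulus_ge0 andbT -x0.
exact: le_unorm.
Qed.

HB.instance Definition _ := Lmodule_isNormed.Build K U unormK_D unormK_Z unormK_0.

Lemma rnorm_unorm (x : U) : rnorm x = unorm x.
Proof. exact: rKK. Qed.

End USpace.

(** * Density, closure and completeness with explicit rates *)

Section Rate.
Variables (R : realType) (k : scalar_kind).
Local Notation K := (scalars R k).
Local Notation rK := (@scalar_of_real R k).
Local Notation re := (@re_scalar R k).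
Local Notation nK := (@modulus R k).

Definition rate (n : nat) : R := n.+1%:R^-1.

Lemma rate_gt0 n : 0 < rate n. Proof. by rewrite invr_gt0. Qed.

Lemma rate_lt e : 0 < e -> exists N, forall n, (N <= n)%N -> rate n < e.
Proof.
move=> e0; have [N _ hN] := near_infty_natSinv_lt (PosNum e0).
by exists N => n Nn; exact: hN.
Qed.

Lemma le_rate (C a b : R) : 0 <= C -> (forall n, a <= b + C * rate n) -> a <= b.
Proof.
move=> C0 h; apply/ler_addgt0Pr => e e0.
have C1 : 0 < C + 1 by lra.
have [N hN] := rate_lt (divr_gt0 e0 C1); have := hN N (leqnn N).
rewrite ltr_pdivlMr // => Ne; apply: le_trans (h N) _; rewrite lerD2l.
have := rate_gt0 N; nra.
Qed.

Lemma ball_rnorm (V : normedModType K) (x y : V) e :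
  ball x (rK e) y <-> rnorm (x - y) < e.
Proof. by rewrite -ball_normE /ball_ /= -rK_rnorm rK_lt. Qed.

Lemma gt0_rK (z : K) : 0 < z -> exists2 e : R, 0 < e & z = rK e.
Proof.
move=> z0; have zE := ge0_rK (ltW z0); exists (re z) => //.
by rewrite -(rK_lt k) rK0 -zE.
Qed.

Lemma denseP (V : normedModType K) (D : set V) :
  dense D <-> forall x e, 0 < e -> exists2 y, D y & rnorm (x - y) < e.
Proof.
split=> [dD x e e0|h O [x Ox] Oo].
  have e0' : 0 < rK e by rewrite -(rK0 R k) rK_lt.
  have [||y [/ball_rnorm xy Dy]] := dD (ball x (rK e)).
  - by exists x; exact: ballxx.
  - exact: ball_open.
  - by exists y.
have /nbhs_ballP [z z0 zO] : nbhs x O by apply: open_nbhs_nbhs.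
have [e e0 ze] := gt0_rK z0; have [y Dy xy] := h x e e0.
by exists y; split=> //; apply: zO; rewrite /= ze; apply/ball_rnorm.
Qed.

Lemma closureP_rnorm (V : normedModType K) (S : set V) x :
  closure S x <-> forall e, 0 < e -> exists2 y, S y & rnorm (x - y) < e.
Proof.
split=> [cx e e0|h B /nbhs_ballP [z z0 zB]].
  have e0' : 0 < rK e by rewrite -(rK0 R k) rK_lt.
  have [y [Sy /ball_rnorm xy]] := cx _ (nbhsx_ballx x _ e0').
  by exists y.
have [e e0 ze] := gt0_rK z0; have [y Sy xy] := h e e0.
by exists y; split=> //; apply: zB; rewrite /= ze; apply/ball_rnorm.
Qed.

(** The filter contains a ball of each radius [rate n]; two members of a proper filter meet, so the
    centres form such a sequence. The constant [C] leaves room for limits found only up to a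
    factor. *)
Lemma complete_of_rate (V : normedModType K) :
    (forall x : nat -> V, (forall n m, rnorm (x n - x m) <= rate n + rate m) ->
       exists e C, forall n, rnorm (x n - e) <= C * rate n) ->
  forall F : set_system V, ProperFilter F -> cauchy F -> cvg F.
Proof.
move=> hV F FF /cauchyP cF.
have /choice [x hx] : forall n, exists x, F (ball x (rK (rate n))).
  by move=> n; apply: cF; rewrite -(rK0 R k) rK_lt rate_gt0.
have [n m|e [C hC]] := hV x.
  have [z [/ball_rnorm nz /ball_rnorm mz]] := filter_ex (filterI (hx n) (hx m)).
  apply: le_trans (rnormBD _ z _) _; rewrite rnormB in mz.
  by rewrite lerD // ltW // rnormB.
apply/cvg_ex; exists e => B /nbhs_ballP [z z0 zB].
have [d d0 ze] := gt0_rK z0.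
have C0 : 0 < `|C| + 1 by have := normr_ge0 C; lra.
have [N hN] := rate_lt (divr_gt0 d0 C0); have := hN N (leqnn N).
rewrite ltr_pdivlMr // => Nd; apply: filterS (hx N) => y /ball_rnorm xy.
apply: zB; rewrite /= ze; apply/ball_rnorm.
apply: le_lt_trans (rnormBD _ (x N) _) _; rewrite rnormB.
have := hC N; have := ler_norm C; have := rate_gt0 N; nra.
Qed.

Lemma banach_limit (E : completeNormedModType K) (C : R) (x : nat -> E) :
    0 <= C -> (forall n m, rnorm (x n - x m) <= C * rate n + C * rate m) ->
  exists e, forall n, rnorm (x n - e) <= C * rate n.
Proof.
move=> C0 hx.
have xcauchy : cauchy (x @ \oo).
  apply: cauchy_exP => z z0; have [d d0 ->] := gt0_rK z0.
  have C1 : 0 < 2 * C + 1 by lra.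
  have [N hN] := rate_lt (divr_gt0 d0 C1); exists (x N).
  exists N => // n /= Nn; apply/ball_rnorm.
  have := hN n Nn; have := hN N (leqnn N); rewrite !ltr_pdivlMr //.
  have := hx N n; have := rate_gt0 N; have := rate_gt0 n; nra.
pose e : E := lim (x @ \oo); have xe : x @ \oo --> e by exact: cauchy_cvg.
exists e => n.
apply/ler_addgt0Pr => d d0.
have d2 : 0 < d / 2 by lra.
have e0 : 0 < rK (d / 2) by rewrite -(rK0 R k) rK_lt.
have [M _ hM] := (cvg_ballP _ _).1 xe _ e0.
have C1 : 0 < C + 1 by lra.
have [N hN] := rate_lt (divr_gt0 d2 C1).
have := hN (maxn N M) (leq_maxl _ _); rewrite ltr_pdivlMr //.
have /ball_rnorm := hM (maxn N M) (leq_maxr _ _).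
have := hx n (maxn N M); have := rnormBD (x n) (x (maxn N M)) e.
rewrite (rnormB e); have := rate_gt0 (maxn N M); nra.
Qed.

(** The intervals of radius [rate n] around [x n] meet pairwise, and the supremum of their left ends
    lies in all of them. *)
Lemma real_limit (x : nat -> R) :
    (forall n m, `|x n - x m| <= rate n + rate m) ->
  exists l, forall n, `|x n - l| <= rate n.
Proof.
move=> hx.
have hx' n m : x n - rate n <= x m + rate m.
  have := hx n m; rewrite ler_norml => /andP[]; lra.
pose S := [set x n - rate n | n in setT].
exists (sup S) => n; rewrite ler_distlC; apply/andP; split.
  by apply: ub_le_sup; [exists (x 0%N + rate 0) => _ [m _ <-]|exists n].
apply: ge_sup => [|_ [m _ <-] //]; by exists (x 0%N - rate 0), 0%N.
Qed.

(** The factor 2 adds the errors of the real and the imaginary part; it reappears in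
    [limit_datum]. *)
Lemma scalar_limit (z : nat -> K) :
    (forall n m, nK (z n - z m) <= rate n + rate m) ->
  exists l, forall n, nK (z n - l) <= 2 * rate n.
Proof.
move=> hz.
have [n m|a ha] := real_limit (x := re \o z).
  rewrite /= -reN -reD; exact: le_trans (re_le_modulus _) (hz n m).
case: (scalars_cases R k) => [reK|[i [im [sqi imE rei]]]].
  exists (rK a) => n; rewrite (reK (z n)) -rKN -rKD modulus_rK.
  have := ha n; have := rate_gt0 n; rewrite /=; lra.
have ni : nK i = 1.
  have : nK i * nK i = 1 by rewrite -modulusM sqi modulusN modulus1.
  have := modulus_ge0 i; nra.
have imre w : im w = - re (w * i).
  rewrite {2}(imE w) mulrDl -mulrA sqi mulrN1 reD reN rKK re_rKM rei.
  by rewrite mulr0 add0r opprK.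
have [n m|b hb] := real_limit (x := im \o z).
  have -> : (im \o z) n - (im \o z) m = re (- (z n - z m) * i).
    by rewrite /= !imre mulNr mulrBl reN reD reN; ring.
  apply: le_trans (re_le_modulus _) _.
  by rewrite modulusM ni mulr1 modulusN.
exists (rK a + rK b * i) => n.
have -> : z n - (rK a + rK b * i) = rK (re (z n) - a) + rK (im (z n) - b) * i.
  by rewrite {1}(imE (z n)) !rKD !rKN; ring.
apply: le_trans (modulusD _ _) _; rewrite modulusM ni mulr1 !modulus_rK.
have := ha n; have := hb n; rewrite /=; lra.
Qed.

End Rate.

Section CompleteCopy.
Variables (K : numFieldType) (V : normedModType K).
Definition completed
    of (forall F : set_system V, ProperFilter F -> cauchy F -> cvg F) : Type := V.
Variable cV : forall F : set_system V, ProperFilter F -> cauchy F -> cvg F.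
HB.instance Definition _ := NormedModule.copy (completed cV) V.
HB.instance Definition _ := Uniform_isComplete.Build (completed cV) cV.
Definition complete_of : completeNormedModType K := completed cV.
End CompleteCopy.

Lemma linear_pack (K : pzRingType) (V W : lmodType K) (f : V -> W) :
    (forall c x y, f (c *: x + y) = c *: f x + f y) ->
  exists F : {linear V -> W}, F =1 f.
Proof.
move=> lf; pose F : {linear V -> W} := HB.pack f (GRing.isLinear.Build K V W *:%R f lf).
by exists F.
Qed.

Lemma rnorm_val (R : realType) (k : scalar_kind)
    (V : normedModType (scalars R k)) (A : submodClosed V)
    (x : linear_subspace A) :
  rnorm (val x) = rnorm x.
Proof. by []. Qed.

Section ClosedSubspace.
Variables (R : realType) (k : scalar_kind).
Local Notation K := (scalars R k).
Variables (E : completeNormedModType K) (A : submodClosed E).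
Hypothesis cA : closed [set x | x \in A].

Lemma closed_subspace_complete (F : set_system (linear_subspace A)) :
  ProperFilter F -> cauchy F -> cvg F.
Proof.
apply: complete_of_rate F => x hx.
have [|n m|e he] := @banach_limit R k E 1 (fun n => val (x n)); rewrite ?mul1r //.
  by rewrite -[val (x n) - _]/(val (x n - x m)) rnorm_val.
have eA : e \in A.
  apply: cA; apply/closureP_rnorm => d d0; have [N hN] := rate_lt d0.
  exists (val (x N)); first exact: valP.
  rewrite rnormB; apply: le_lt_trans (he N) _.
  by rewrite mul1r hN.
exists (Sub e eA), 1 => n; rewrite -rnorm_val.
exact: he.
Qed.

Definition closed_subspace : completeNormedModType K :=
  complete_of closed_subspace_complete.

End ClosedSubspace.

(** * Limits of sequences as extension problems *)

Section Limits.
Variables (R : realType) (k : scalar_kind).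
Local Notation K := (scalars R k).
Local Notation nK := (@modulus R k).
Variables (J : Type) (iota : nat -> J) (index : J -> nat).
Hypothesis iotaK : cancel iota index.
Local Notation Kholds := (@holds R k J K^o nK).

(** Each unknown is to be a limit of [v1 \o iota] at the rate that [scalar_limit] achieves. All
    unknowns share the same conditions, so any of them serves as the limit. *)
Definition limit_datum (M : R) : datum R k J :=
  Datum (fun s r => exists n j,
    s = [:: (1, inl (iota n)); (-1, inr j)] /\ r = 2 * rate R n) (fun=> M).

Lemma holds_limit (V : lmodType K) (p : V -> R) M v1 v2 :
  holds p (limit_datum M) v1 v2 <->
  (forall n j, p (v1 (iota n) - v2 j) <= 2 * rate R n) /\
  (forall j, p (v2 j) <= `|M|).
Proof.
have cE n j : comb v1 v2 [:: (1, inl (iota n)); (-1, inr j)] = v1 (iota n) - v2 j.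
  by rewrite /comb !big_cons big_nil addr0 scale1r scaleN1r.
split=> [[h1 h2]|[h1 h2]]; split=> //.
  by move=> n j; rewrite -cE; apply: h1; exists n, j.
by move=> _ _ [n [j [-> ->]]]; rewrite cE.
Qed.

Section Complete.
Variables (L : lmodType K) (rho : L -> R) (adm : datum R k J -> Prop).
Hypothesis srho : seminorm rho.
Hypothesis adm_limit : forall M, adm (limit_datum M).
Local Notation U := (uspace adm srho).

Lemma uspace_complete (F : set_system U) :
  ProperFilter F -> cauchy F -> cvg F.
Proof.
apply: complete_of_rate F => x hx.
have /choice [t ht] : forall n, exists t, x n = uclass adm srho t.
  by move=> n; exact: uclass_surj.
(* [M] must be one constant for all functionals: each scalar limit lies within [2 * rate R 0] of
   [z 0], whose modulus is at most [rnorm (x 0)]. *)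
pose u := t \o index; pose M := rnorm (x 0%N) + 2 * rate R 0.
have uE n : u (iota n) = t n by rewrite /u /= iotaK.
have sol : solvable (functional rho adm) (limit_datum M) u.
  move=> g Dg; pose z n := g (t n).
  have zE n : z n = ufun (x n) (exist _ g Dg) by rewrite ht.
  have [n m|l hl] := @scalar_limit R k z.
    apply: le_trans (hx n m); rewrite rnorm_unorm !zE.
    exact: le_unorm (x n - x m) (exist _ g Dg).
  exists (fun=> l); apply/holds_limit; split=> [n _|_].
    by rewrite /= uE; exact: hl.
  rewrite (le_trans _ (ler_norm _)) //.
  have := modulusBD l (z 0%N) 0; rewrite !subr0 modulusB => h.
  apply: le_trans h _; rewrite addrC lerD //.
  by rewrite zE rnorm_unorm le_unorm.
exists (uclass adm srho (Node (limit_datum M) u (iota 0))), 2 => n.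
rewrite rnorm_unorm; apply: unorm_le => -[g Dg].
have /holds_limit [h _] :=
  (consistent_functional rho adm).2 _ _ (adm_limit M) sol _ Dg.
by have := h n (iota 0); rewrite /= uE ht.
Qed.

Definition uspace_banach : completeNormedModType K :=
  complete_of uspace_complete.

End Complete.

Lemma banach_limit_datum (E : completeNormedModType K) M (v1 : J -> E) :
    (forall f, lin f -> (forall x, nK (f x) <= rnorm x) ->
       exists v, Kholds (limit_datum M) (f \o v1) v) ->
  exists v2, holds (@rnorm R k E) (limit_datum M) v1 v2.
Proof.
move=> h.
have sE := seminorm_rnorm E.
have [|n m|e he] := @banach_limit R k E 2 (v1 \o iota) => //.
  have [f [lf fle <-]] := norming_functional ((v1 \o iota) n - (v1 \o iota) m) sE.
  have [v /holds_limit [hv _]] := h f lf fle.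
  rewrite (linB lf); apply: le_trans (modulusBD _ (v (iota 0)) _) _.
  rewrite lerD //; first exact: hv.
  by rewrite modulusB; exact: hv.
exists (fun=> e); apply/holds_limit; split=> [n _|_]; first exact: he.
(* Seen through [f], both [e] and the scalar solution are within [2 * rate R n] of the n-th
   entry. *)
apply: (@le_rate R 4) => // n.
have [f [lf fle <-]] := norming_functional e sE.
have [v /holds_limit [hv hM]] := h f lf fle.
have := modulusBD (f e) (f (v1 (iota n))) 0; rewrite !subr0 => h1.
have := modulusBD (f (v1 (iota n))) (v (iota 0)) 0; rewrite !subr0 => h2.
have := hv n (iota 0); have := hM (iota 0).
have := fle (v1 (iota n) - e); rewrite (linB lf) modulusB => h3.
have := he n; rewrite /= in h3 *; lra.
Qed.

End Limits.

(** * The base space and the dual of the constructed space *)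

Section Embedding.
Variables (R : realType) (k : scalar_kind).
Local Notation K := (scalars R k).
Local Notation nK := (@modulus R k).
Variables (L : lmodType K) (J : Type) (rho : L -> R) (adm : datum R k J -> Prop).
Hypothesis srho : seminorm rho.
Local Notation U := (uspace adm srho).
Local Notation uclass := (uclass adm srho).

Lemma ufunE t g Dg : ufun (uclass t) (exist _ g Dg) = g t.
Proof. by []. Qed.

Lemma uspace_eq (x y : U) : (forall g, ufun x g = ufun y g) -> x = y.
Proof. by move=> h; apply: val_inj; apply/funext. Qed.

Lemma uclass_Comb c s t : uclass (Comb c s t) = c *: uclass s + uclass t.
Proof.
apply: uspace_eq => -[g Dg]; rewrite ufun_lin !ufunE.
by have [gC _ _ _] := (consistent_functional rho adm).1 _ Dg.
Qed.

Lemma uclass_Base c x y :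
  uclass (Base J (c *: x + y)) = c *: uclass (Base J x) + uclass (Base J y).
Proof.
apply: uspace_eq => -[g Dg]; rewrite ufun_lin !ufunE.
by have [_ gB _ _] := (consistent_functional rho adm).1 _ Dg; exact: gB.
Qed.

Lemma rnorm_uclass_Base x : rnorm (uclass (Base J x)) = rho x.
Proof.
rewrite rnorm_unorm; apply: le_anti; apply/andP; split.
  apply: unorm_le => -[g Dg]; rewrite ufunE.
  by have [_ _ gr _] := (consistent_functional rho adm).1 _ Dg.
have [f [lf fle <-]] := norming_functional x srho.
have Dg : functional rho adm (@teval R k L J K^o f (fun d _ w => solve d w)).
  apply: teval_functional => // [d u w j|d u w _ _]; first exact: solve_bound.
  exact: solveP.
exact: le_unorm (uclass (Base J x)) (exist _ _ Dg).
Qed.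

(** Lets Hahn-Banach on [U] produce members of the family, to which [modify_functional] applies. *)
Lemma functional_of_dual (f : U -> K) : lin f ->
  (forall x, nK (f x) <= rnorm x) -> functional rho adm (f \o uclass).
Proof.
move=> lf fle; apply: (tnorm_functional srho) => [c s t|t] /=.
  by rewrite uclass_Comb lf.
by rewrite -unorm_uclass -rnorm_unorm.
Qed.

Lemma uspace_lift (W : normedModType K) (r : term L J -> W) :
    (forall c s t, r (Comb c s t) = c *: r s + r t) ->
    (forall t, rnorm (r t) <= tnorm rho adm t) ->
  exists P : {linear U -> W},
    (forall t, P (uclass t) = r t) /\ forall x, rnorm (P x) <= rnorm x.
Proof.
move=> rC rle.
have rE s t : uclass s = uclass t -> r s = r t.
  move=> st; apply/eqP; rewrite -subr_eq0; apply/eqP; apply: rnorm0_eq0.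
  apply: le_anti; rewrite rnorm_ge0 andbT.
  have -> : r s - r t = r (Comb (-1) t s) by rewrite rC scaleN1r addrC.
  apply: le_trans (rle _) _; rewrite -(unorm_uclass adm srho) -rnorm_unorm.
  by rewrite uclass_Comb st scaleN1r addNr rnorm0.
have /choice [rep hrep] : forall x : U, exists t, x = uclass t.
  by move=> x; exact: uclass_surj.
have PE t : r (rep (uclass t)) = r t by apply: rE; rewrite -hrep.
have [P hP] : exists P : {linear U -> W}, P =1 r \o rep.
  apply: linear_pack => c x y /=.
  by rewrite {1}(hrep x) {1}(hrep y) -uclass_Comb PE rC.
exists P; split=> [t|x]; rewrite hP /=; first exact: PE.
by apply: le_trans (rle _) _; rewrite -(unorm_uclass adm srho) -hrep rnorm_unorm.
Qed.

End Embedding.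

(** * The contractive retraction onto the base *)

Section Retraction.
Variables (R : realType) (k : scalar_kind).
Local Notation K := (scalars R k).
Local Notation nK := (@modulus R k).
Variables (E : completeNormedModType K) (J : Type).
Local Notation Kholds := (@holds R k J K^o nK).
Local Notation Eholds := (@holds R k J E (@rnorm R k E)).

(** The premise is what solvability says for the family of all [f \o r], where [r] evaluates terms
    in [E] and [f] is a contractive functional. *)
Definition extendable (d : datum R k J) :=
  forall v1 : J -> E,
    (forall f, lin f -> (forall x, nK (f x) <= rnorm x) ->
       exists v, Kholds d (f \o v1) v) ->
  exists v2, Eholds d v1 v2.

Let F (d : datum R k J) (u : J -> term E J) (w : J -> E) : J -> E :=
  xget (fun=> 0) [set v | Eholds d w v].

Let r : term E J -> E := teval id F.

Let dual_r : set (term E J -> K) :=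
  [set g | exists f, [/\ lin f, forall x, nK (f x) <= rnorm x & g = f \o r]].

(** Solvability over this family is the premise of [extendable] at [r \o u], so [F] returns a true
    solution in [E] and each [f] inherits its bounds. Being consistent, the family lies in the
    largest one, which makes [r] contractive for [tnorm]. *)
Lemma consistent_dual_retraction :
  consistent (@rnorm R k E) extendable dual_r.
Proof.
split=> [_ [f [lf fle ->]]|d u ad sol _ [f [lf fle ->]]].
  split=> //= [c s t|d u j]; first by rewrite lf.
  apply: le_trans (fle _) _; rewrite /r /= /F; case: xgetP => [v _ []//|_].
  by rewrite rnorm0.
have [v2 hv2] : exists v2, Eholds d (r \o u) v2.
  apply: ad => h lh hle; apply: (sol (h \o r)); by exists h.
have [hF1 hF2] : Eholds d (r \o u) (F d u (r \o u)) by exact: (xgetI _ hv2).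
split=> [s c sc|j]; last by apply: le_trans (fle _) _; exact: hF2.
rewrite -(@comb_morph R k J E K^o f (r \o u) (r \o Node d u) s lf).
by apply: le_trans (fle _) _; exact: hF1.
Qed.

Lemma retraction : exists P : {linear uspace extendable (seminorm_rnorm E) -> E},
  (forall x, P (uclass extendable (seminorm_rnorm E) (Base J x)) = x) /\
  forall x, rnorm (P x) <= rnorm x.
Proof.
have [//|t|P [PE Ple]] := @uspace_lift R k E J _ extendable (seminorm_rnorm E) E r.
  have [f [lf fle <-]] := norming_functional (r t) (seminorm_rnorm E).
  apply: (@le_tnorm R k E J (@rnorm R k E) extendable (f \o r)).
  by exists dual_r; [exact: consistent_dual_retraction|exists f].
by exists P; split=> // x; rewrite PE.
Qed.

End Retraction.

(** * Amalgamation of isometries and universal disposition *)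

Section Amalgam.
Variables (R : realType) (k : scalar_kind).
Local Notation K := (scalars R k).
Local Notation nK := (@modulus R k).
Lemma into_isometry_rnorm (V W : normedModType K) (f : {linear V -> W}) x :
  into_isometry f -> rnorm (f x) = rnorm x.
Proof. by move=> hf; rewrite /rnorm hf. Qed.

Lemma into_isometry_inj (V W : normedModType K) (f : {linear V -> W}) :
  into_isometry f -> injective f.
Proof.
move=> hf x y e; apply/eqP; rewrite -subr_eq0; apply/eqP; apply: rnorm0_eq0.
by rewrite -(into_isometry_rnorm _ hf) linearB e subrr rnorm0.
Qed.

Variables (J : Type) (A B : normedModType K) (i : {linear A -> B}).
Variables (w : J -> A) (y : J -> B).
Hypothesis isoi : into_isometry i.
Hypothesis surjw : forall a, exists j, w j = a.
Hypothesis surjy : forall b, exists j, y j = b.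
Local Notation Kholds := (@holds R k J K^o nK).

(** The given vectors name [A], the unknowns name [B], and the conditions record every norm in [B]
    of a combination of both. Combinations of norm 0 enforce the linear relations, including the
    gluing along [i]. *)
Definition amalgam_datum : datum R k J :=
  Datum (fun s r => r = rnorm (comb (i \o w) y s)) (fun j => rnorm (y j)).

Lemma holds_amalgam (V : lmodType K) (p : V -> R) (h : B -> V) :
    (forall c x z, h (c *: x + z) = c *: h x + h z) ->
    (forall b, p (h b) <= rnorm b) ->
  holds p amalgam_datum (h \o i \o w) (h \o y).
Proof.
move=> lh hp; split=> [s _ ->|j]; last first.
  by apply: le_trans (hp _) (ler_norm _).
by rewrite -[h \o i \o w]/(h \o (i \o w)) -comb_morph.
Qed.

(** Combinations that vanish in [B] must vanish on [v1] and [v2]; hence [v2] factors linearly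
    through [y] and determines [v1]. With [holds_amalgam], scalar solutions amount to contractive
    functionals on [B]. *)
Lemma amalgam_holds (v1 v2 : J -> K) : Kholds amalgam_datum v1 v2 ->
  exists h, [/\ lin h, forall b, nK (h b) <= rnorm b,
    forall j, v1 j = h (i (w j)) & forall j, v2 j = h (y j)].
Proof.
move=> [hc hb]; have [jy hjy] := choice surjy.
have eq0 s : comb (i \o w) y s = 0 -> @comb R k J K^o v1 v2 s = 0.
  move=> s0; apply: (@modulus0_eq0 R k); apply: le_anti.
  by rewrite modulus_ge0 andbT -(rnorm0 B) -s0; exact: hc.
have v2E j1 j2 : y j1 = y j2 -> v2 j1 = v2 j2.
  move=> y12; have := eq0 [:: (1, inr j1); (-1, inr j2)].
  rewrite /comb !big_cons !big_nil /= !addr0 scale1r scaleN1r y12 subrr.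
  rewrite -[_ *: (_ : K^o)]/(_ * _) -[_ *: (_ : K^o)]/(_ * _) mul1r mulN1r.
  by move=> /(_ erefl) /eqP; rewrite subr_eq0 => /eqP.
exists (fun b => v2 (jy b)); split=> [c x z|b|j|j].
- have := eq0 [:: (c, inr (jy x)); (1, inr (jy z)); (-1, inr (jy (c *: x + z)))].
  rewrite /comb !big_cons !big_nil /= !addr0 !hjy scale1r scaleN1r.
  rewrite -[c *: (_ : K^o)]/(_ * _) -[1 *: (_ : K^o)]/(_ * _).
  rewrite -[-1 *: (_ : K^o)]/(_ * _) mul1r mulN1r addrA subrr => /(_ erefl).
  by rewrite addrA => /eqP; rewrite subr_eq0 => /eqP ->.
- by apply: le_trans (hb _) _; rewrite /= hjy ger0_norm // rnorm_ge0.
- have := eq0 [:: (1, inl j); (-1, inr (jy (i (w j))))].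
  rewrite /comb !big_cons !big_nil /= !addr0 !hjy scale1r scaleN1r subrr.
  rewrite -[1 *: (_ : K^o)]/(_ * _) -[-1 *: (_ : K^o)]/(_ * _) mul1r mulN1r.
  by move=> /(_ erefl) /eqP; rewrite subr_eq0 => /eqP.
- by apply: v2E; rewrite hjy.
Qed.

Section Disposition.
Variables (L : lmodType K) (rho : L -> R) (adm : datum R k J -> Prop).
Hypothesis srho : seminorm rho.
Hypothesis adm_amalgam : adm amalgam_datum.
Local Notation U := (uspace adm srho).
Variable u : {linear A -> U}.
Hypothesis isou : into_isometry u.

Lemma uspace_disposition :
  exists2 u' : {linear B -> U}, into_isometry u' & u =1 u' \o i.
Proof.
have /choice [u0 hu0] : forall j, exists t, u (w j) = uclass adm srho t.
  by move=> j; exact: uclass_surj.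
have [jy hjy] := choice surjy.
have ufun_u g j (Dg : functional rho adm g) :
    g (u0 j) = ufun (u (w j)) (exist _ g Dg) by rewrite hu0.
(* Each functional of the family, pulled back to [A] by [u], extends along the isometry [i] to
   [B]. *)
have sol : solvable (functional rho adm) amalgam_datum u0.
  move=> g Dg; pose f x := ufun (u x) (exist _ g Dg).
  pose S b a := exists x, b = i x /\ a = f x.
  have [||b a [x [-> ->]]|h [lh hle hS]] :=
      hahn_banach_rel (S := S) (seminorm_rnorm B).
  - by exists 0; rewrite /f !linear0.
  - move=> c x z a b [s [-> ->]] [t [-> ->]]; exists (c *: s + t).
    by rewrite /f !linearP.
  - rewrite (into_isometry_rnorm _ isoi) -(into_isometry_rnorm _ isou).
    by rewrite rnorm_unorm; exact: le_unorm.
  exists (h \o y).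
  have -> : g \o u0 = h \o i \o w.
    by apply/funext => j; rewrite /= ufun_u (hS _ (f (w j))) //; exists (w j).
  exact: (@holds_amalgam K^o).
have node g (Dg : functional rho adm g) := amalgam_holds
  ((consistent_functional rho adm).2 _ _ adm_amalgam sol g Dg).
pose v b := uclass adm srho (Node amalgam_datum u0 (jy b)).
have [u' u'E] : exists u' : {linear B -> U}, u' =1 v.
  apply: linear_pack => c x z; apply: uspace_eq => -[g Dg].
  have [h [lh _ _ hy]] := node g Dg; rewrite ufun_lin !ufunE.
  by have := hy (jy _); rewrite /= => e; rewrite !e !hjy lh.
exists u' => [b|a]; last first.
  rewrite /= u'E; apply: uspace_eq => -[g Dg].
  have [h [_ _ hw hy]] := node g Dg; have [j <-] := surjw a.
  rewrite -ufun_u ufunE; have := hy (jy (i (w j))); rewrite /= => ->.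
  by have := hw j; rewrite /= hjy => ->.
rewrite -!rK_rnorm; congr scalar_of_real; rewrite rnorm_unorm u'E.
apply: le_anti; apply/andP; split.
  apply: unorm_le => -[g Dg]; have [h [_ hle _ hy]] := node g Dg.
  by rewrite ufunE; have := hy (jy b); rewrite /= hjy => ->.
(* For the lower bound, a functional [h] norming [b] is carried from [i A] to [u A], extended to
   [U], and altered at the node so as to take the values [h \o y] there. *)
have [h [lh hle <-]] := norming_functional b (seminorm_rnorm B).
pose S x a := exists z, x = u z /\ a = h (i z).
have [||x a [z [-> ->]]|f [lf fle fS]] :=
    hahn_banach_rel (S := S) (seminorm_rnorm U).
- by exists 0; rewrite !linear0 (lin0 lh).
- move=> c x z a a' [s [-> ->]] [t [-> ->]]; exists (c *: s + t).
  by rewrite !linearP lh.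
- rewrite (into_isometry_rnorm _ isou) -(into_isometry_rnorm _ isoi).
  exact: hle.
have Df := functional_of_dual lf fle.
have fu0 : f \o uclass adm srho \o u0 = h \o i \o w.
  by apply/funext => j; rewrite /= -hu0; apply: fS; exists (w j).
have [|g' [Dg' _ hg']] := @modify_functional R k L J rho adm _ _ u0 (h \o y)
    Df adm_amalgam sol.
  by rewrite -[_ \o u0]/(f \o uclass adm srho \o u0) fu0; exact: (@holds_amalgam K^o).
have := le_unorm (v b) (exist _ g' Dg'); rewrite /v ufunE.
by have := congr1 (fun q => q (jy b)) hg'; rewrite /= hjy => ->.
Qed.

End Disposition.
End Amalgam.

(** * Operator norms and density characters *)

Section OperatorNorm.
Variables (R : realType) (k : scalar_kind).
Local Notation K := (scalars R k).
Variables (V W : normedModType K) (f : {linear V -> W}).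

Lemma opnorm_le M :
  0 <= M -> (forall x, rnorm (f x) <= M * rnorm x) -> opnorm f <= M.
Proof. by move=> M0 hM; apply: ge_inf => //; exists 0 => r []. Qed.

Hypothesis bf : bounded_operator f.

Let nonempty : [set M : R | 0 <= M /\ forall x, rnorm (f x) <= M * rnorm x] !=set0.
Proof.
have [M hM] := bf; exists `|M|; split=> // x.
by apply: le_trans (hM x) _; rewrite ler_wpM2r ?rnorm_ge0 ?ler_norm.
Qed.

Lemma opnorm_ge0 : 0 <= opnorm f.
Proof. by apply: lb_le_inf => // M []. Qed.

Lemma le_opnorm x : rnorm (f x) <= opnorm f * rnorm x.
Proof.
have [x0|x0] := eqVneq (rnorm x) 0.
  by rewrite (rnorm0_eq0 x0) linear0 !rnorm0 mulr0.
have xpos : 0 < rnorm x by rewrite lt_def x0 rnorm_ge0.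
rewrite -ler_pdivrMr //; apply: lb_le_inf => // M [_ hM].
by rewrite ler_pdivrMr.
Qed.

End OperatorNorm.

Section Density.
Variables (R : realType) (k : scalar_kind).
Local Notation K := (scalars R k).
Local Notation nK := (@modulus R k).

Section AddLine.
Variables (V : normedModType K) (S : set V).
Hypothesis hS : subspace_axiom S.

Lemma subspace_scale c x : S x -> S (c *: x).
Proof. by move=> Sx; have := hS.2 c x 0 Sx hS.1; rewrite addr0. Qed.
Lemma subspace_add x y : S x -> S y -> S (x + y).
Proof. by move=> Sx Sy; have := hS.2 1 x y Sx Sy; rewrite scale1r. Qed.

Let dist x := inf [set rnorm (x - s) | s in S].

Let dist_le x s : S s -> dist x <= rnorm (x - s).
Proof.
move=> Ss; apply: ge_inf; last by exists s.
by exists 0 => _ [r _ <-]; exact: rnorm_ge0.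
Qed.

Let le_dist r x : (forall s, S s -> r <= rnorm (x - s)) -> r <= dist x.
Proof.
move=> h; apply: lb_le_inf => [|_ [s Ss <-]]; last exact: h.
by exists (rnorm (x - 0)), 0 => //; exact: hS.1.
Qed.

Let seminorm_dist : seminorm dist.
Proof.
apply: seminorm_of_le => [x y||c x c0].
- rewrite -lerBlDr; apply/le_dist => s Ss; rewrite lerBlDr -lerBlDl.
  apply/le_dist => r Sr; rewrite lerBlDl.
  apply: le_trans (dist_le _ (subspace_add Ss Sr)) _.
  by rewrite opprD addrACA rnormD.
- by apply: le_trans (dist_le _ hS.1) _; rewrite subr0 rnorm0.
- have nc := modulus_gt0 c0; rewrite mulrC -ler_pdivrMr //.
  apply/le_dist => s Ss.
  rewrite ler_pdivrMr //; apply: le_trans (dist_le _ (subspace_scale c Ss)) _.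
  by rewrite -scalerBr rnormZ mulrC.
Qed.

(** For [e] outside [S], the distance to [S] yields a functional [f] that vanishes on [S] but not at
    [e]. The continuous projection [x - (f x / f e) e] maps the sum into [S], which is closed; the
    constant [M] below bounds its norm. *)
Lemma closed_add_line (e : V) :
  closed S -> closed [set x | exists c : K, S (x - c *: e)].
Proof.
move=> cS.
have [Se|nSe] := pselect (S e).
  suff -> : [set x | exists c : K, S (x - c *: e)] = S by [].
  apply/seteqP; split=> x; last by exists 0; rewrite scale0r subr0.
  by case=> c h; have := subspace_add h (subspace_scale c Se); rewrite subrK.
have [f [lf fle fe]] := norming_functional e seminorm_dist.
have f0 s : S s -> f s = 0.
  move=> Ss; apply: modulus0_eq0; apply: le_anti; rewrite modulus_ge0 andbT.
  apply: le_trans (fle s) _; apply: le_trans (dist_le _ Ss) _.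
  by rewrite subrr rnorm0.
have fle1 x : nK (f x) <= rnorm x.
  by apply: le_trans (fle x) _; have := dist_le x hS.1; rewrite subr0.
have fe0 : f e != 0.
  apply/eqP => fe0; apply: nSe; apply: cS; apply/closureP_rnorm => d d0.
  have de : dist e < d by rewrite -fe fe0 modulus0.
  apply: contrapT => nex; move: de; apply/negP; rewrite -leNgt.
  apply/le_dist => s Ss; rewrite leNgt; apply/negP => sd; apply: nex.
  by exists s.
move=> x /closureP_rnorm cx; exists (f x / f e); apply: cS.
apply/closureP_rnorm => d d0; pose M := 1 + nK (f e)^-1 * rnorm e.
have M0 : 0 < M.
  have := mulr_ge0 (modulus_ge0 (f e)^-1) (rnorm_ge0 e); rewrite /M; lra.
have [y [c hy] xy] := cx _ (divr_gt0 d0 M0).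
exists (y - c *: e) => //.
have fy : c = f y / f e.
  have := f0 _ hy; rewrite (linB lf) (linZ lf) => /eqP.
  by rewrite subr_eq0 => /eqP ->; rewrite mulfK.
have -> : x - f x / f e *: e - (y - c *: e) = (x - y) - (f (x - y) / f e) *: e.
  rewrite (linB lf) mulrBl -fy scalerBl !opprD !opprK.
  by rewrite -!addrA; congr (_ + _); rewrite addrCA.
apply: le_lt_trans (rnormD _ _) _; rewrite rnormN rnormZ modulusM.
move: xy; rewrite ltr_pdivlMr //; apply: le_lt_trans.
rewrite /M mulrDr mulr1 lerD2l -mulrA ler_wpM2r //.
by rewrite mulr_ge0 // ?modulus_ge0 // rnorm_ge0.
Qed.

End AddLine.

Definition span_set (V : lmodType K) n (e : 'I_n -> V) : set V :=
  [set x | exists c : 'I_n -> K, x = \sum_(i < n) c i *: e i].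

Lemma span_set_subspace (V : lmodType K) n (e : 'I_n -> V) :
  subspace_axiom (span_set e).
Proof.
split; first by exists (fun=> 0); rewrite big1 // => i _; rewrite scale0r.
move=> c _ _ [x ->] [y ->]; exists (fun i => c * x i + y i).
rewrite scaler_sumr -big_split; apply: eq_bigr => i _.
by rewrite scalerDl scalerA.
Qed.

(** Closedness serves the convention at [aleph_0]: a dense finite-dimensional subspace is the whole
    space. *)
Lemma closed_span_set (V : normedModType K) n (e : 'I_n -> V) :
  closed (span_set e).
Proof.
elim: n e => [|n IH] e.
  move=> x /closureP_rnorm cx; exists (fun=> 0); rewrite big_ord0.
  apply: rnorm0_eq0; apply: le_anti; rewrite rnorm_ge0 andbT.
  apply/ler_addgt0Pr => d d0; have [_ [c ->]] := cx d d0.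
  by rewrite big_ord0 subr0 add0r => /ltW.
suff -> : span_set e =
    [set x | exists c : K, span_set (e \o lift ord0) (x - c *: e ord0)].
  apply: closed_add_line; [exact: span_set_subspace|exact: IH].
apply/seteqP; split=> x.
  case=> c ->; exists (c ord0), (c \o lift ord0).
  by rewrite big_ord_recl addrC addrA addNr add0r.
case=> a [c /eqP]; rewrite subr_eq => /eqP ->.
exists (fun i => if unlift ord0 i is Some j then c j else a).
rewrite big_ord_recl unlift_none addrC; congr (_ + _).
by apply: eq_bigr => i _; rewrite liftK.
Qed.

Lemma card_lt_image (T U V : Type) (f : T -> U) (D : set T) (X : set V) :
  card_lt D X -> card_lt (f @` D) X.
Proof.
move=> [DX nXD]; split; first exact: card_le_trans (card_image_le f D) DX.
by move=> h; apply: nXD; exact: card_le_trans h (card_image_le f D).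
Qed.

Lemma dens_lt_dense_range (V W : normedModType K) (f : {linear V -> W}) M
    (c : Type) :
    (forall x, rnorm (f x) <= M * rnorm x) ->
    (forall y e, 0 < e -> exists x, rnorm (y - f x) < e) ->
  dens_lt V c -> dens_lt W c.
Proof.
move=> fM fd; rewrite /dens_lt; case: ifP => _.
  case=> n [e he]; exists n, (f \o e) => y.
  have : span_set (f \o e) y.
    apply: closed_span_set; apply/closureP_rnorm => d d0.
    have [x yx] := fd y d d0; exists (f x) => //; have [a ->] := he x.
    by exists a; rewrite linear_sum; apply: eq_bigr => i _; rewrite linearZ.
  by case=> a ->; exists a.
case=> D /denseP dD cD; exists (f @` D); last exact: card_lt_image.
apply/denseP => y d d0; have d2 : 0 < d / 2 by lra.
have [x yx] := fd y _ d2; have M0 : 0 < `|M| + 1 by have := normr_ge0 M; lra.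
have [z Dz xz] := dD x _ (divr_gt0 d2 M0); exists (f z); first by exists z.
apply: le_lt_trans (rnormBD _ (f x) _) _; rewrite -linearB.
move: xz; rewrite ltr_pdivlMr // => xz.
have := fM (x - z); have := ler_norm M; have := rnorm_ge0 (x - z); nra.
Qed.

(** A point is coded by a sequence in a dense set enumerated by [b], or by coefficients in finite
    dimension, so one index type covers all spaces of density below [b]. The factor [nat] makes room
    for the sequences of [limit_datum]. *)
Lemma dens_lt_surjection (b : Type) (B : normedModType K) : dens_lt B b ->
  exists y : nat * ((nat -> b) + (nat -> K)) -> B, forall x, exists j, y j = x.
Proof.
rewrite /dens_lt; case: ifP => _.
  case=> n [e he].
  exists (fun j => if j.2 is inr c then \sum_(i < n) c (val i) *: e i else 0) => x.
  have [c ->] := he x.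
  exists (0%N, inr (fun i => if insub i is Some i' then c i' else 0)) => /=.
  by apply: eq_bigr => i _; rewrite valK.
case=> D /denseP dD [/pcard_surjP [sigma hsigma] _].
(* At most one point is [near s]; codes without a limit go to 0. *)
pose near s x := forall n, rnorm (x - sigma (s n)) < rate R n.
exists (fun j => if j.2 is inl s then xget 0 [set x | near s x] else 0) => x.
have /choice [s hs] : forall n, exists c, rnorm (x - sigma c) < rate R n.
  move=> n; have [d Dd xd] := dD x _ (rate_gt0 R n).
  by have [c _ cd] := hsigma d Dd; exists c; rewrite cd.
exists (0%N, inl s) => /=; have : near s x by [].
move=> /(xgetI 0 (P := [set x | near s x])); set z := xget _ _ => zs.
apply/eqP; rewrite -subr_eq0; apply/eqP; apply: rnorm0_eq0; apply: le_anti.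
rewrite rnorm_ge0 andbT; apply: (@le_rate R 2) => // n; rewrite add0r.
apply: le_trans (rnormBD _ (sigma (s n)) _) _.
by have := hs n; have := zs n; rewrite (rnormB (sigma _)); lra.
Qed.

End Density.

(** * From injectivity to a complemented subspace *)

Section InjectiveRetract.
Variables (R : realType) (k : scalar_kind).
Local Notation K := (scalars R k).
Local Notation nK := (@modulus R k).

Lemma corestrict (V : lmodType K) (W : normedModType K) (A : submodClosed W)
    (f : {linear V -> W}) (fA : forall x, f x \in A) :
  exists g : {linear V -> linear_subspace A}, forall x, val (g x) = f x.
Proof.
have [g hg] : exists g : {linear V -> linear_subspace A},
    g =1 fun x => LinearSubspace (fA x).
  apply: linear_pack => c x y; apply: val_inj.
  by rewrite [RHS]linearP /= linearP.
by exists g => x; rewrite hg.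
Qed.

Lemma range_subspace (V W : lmodType K) (f : {linear V -> W}) :
  subspace_axiom (range f).
Proof.
split; first by exists 0; rewrite ?linear0.
by move=> c _ _ [x _ <-] [y _ <-]; exists (c *: x + y); rewrite ?linearP.
Qed.

Definition range_submod (V W : lmodType K) (f : {linear V -> W}) :
  submodClosed W := submod_of (range_subspace f).

Lemma mem_range_submod (V W : lmodType K) (f : {linear V -> W}) x :
  f x \in range_submod f.
Proof. by apply/asboolP; exists x. Qed.

Section InjectiveExtension.
Variables (a b : Type) (E : completeNormedModType K).
Hypothesis injE : injective_space a b 1 E.
Variables A B : completeNormedModType K.
Hypotheses (dA : dens_lt A a) (dB : dens_lt B b).
Variable i : {linear A -> B}.
Hypothesis isoi : into_isometry i.

Lemma injective_extension (t : {linear A -> E}) :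
    (forall x, rnorm (t x) <= rnorm x) ->
  exists T : {linear B -> E},
    (forall x, rnorm (T x) <= rnorm x) /\ forall x, T (i x) = t x.
Proof.
move=> tle; have [i' i'E] := corestrict (mem_range_submod i).
have rng (y : linear_subspace (range_submod i)) : exists x, i' x = y.
  case: y => y ry; have /asboolP [x _ xy] := ry.
  by exists x; apply: val_inj; rewrite i'E.
have [p pE] := choice rng.
have i'n x : rnorm (i' x) = rnorm x.
  by rewrite -rnorm_val i'E (into_isometry_rnorm _ isoi).
have i'I x y : i' x = i' y -> x = y.
  move=> e; apply/eqP; rewrite -subr_eq0; apply/eqP; apply: rnorm0_eq0.
  by rewrite -i'n linearB e subrr rnorm0.
have [q qE] : exists q : {linear linear_subspace (range_submod i) -> E},
    q =1 t \o p.
  apply: linear_pack => c x y; rewrite /= -linearP; congr (t _).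
  by apply: i'I; rewrite linearP !pE.
have qle x : rnorm (q x) <= 1 * rnorm x.
  by rewrite mul1r qE -{2}(pE x) i'n tle.
have bq : bounded_operator q by exists 1.
have dS : dens_lt (linear_subspace (range_submod i)) a.
  apply: (dens_lt_dense_range (f := i') (M := 1)) dA => [x|y e e0].
    by rewrite i'n mul1r.
  by have [x <-] := rng y; exists x; rewrite subrr rnorm0.
have [T [bT TE Tn]] := injE dB dS bq.
exists T; split=> [x|x]; last first.
  rewrite -i'E TE qE /=; congr (t _); apply: i'I; exact: pE.
apply: le_trans (le_opnorm bT x) _; rewrite -[leRHS]mul1r.
rewrite ler_wpM2r ?rnorm_ge0 //; apply: le_trans Tn _; rewrite mul1r.
exact: opnorm_le.
Qed.

(** Functionals separate the points of [E], so the scalar solutions force [v1] to factor through [w]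
    by a contraction [t] on [A]; an extension of [t] along [i] supplies the unknowns. *)
Lemma extendable_amalgam (J : Type) (w : J -> A) (y : J -> B) :
    (forall x, exists j, w j = x) -> (forall x, exists j, y j = x) ->
  extendable E (amalgam_datum i w y).
Proof.
move=> surjw surjy v1 hv1.
have [jw hjw] := choice surjw.
have dualE (x z : E) : (forall f, lin f ->
    (forall x, nK (f x) <= rnorm x) -> f x = f z) -> x = z.
  move=> h; apply/eqP; rewrite -subr_eq0; apply/eqP; apply: rnorm0_eq0.
  have [f [lf fle <-]] := norming_functional (x - z) (seminorm_rnorm E).
  by rewrite (linB lf) (h f) // subrr modulus0.
have dual f : lin f -> (forall x, nK (f x) <= rnorm x) ->
    exists h : B -> K, [/\ lin h, forall x, nK (h x) <= rnorm x &
      forall j, f (v1 j) = h (i (w j))].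
  move=> lf fle; have [v hv] := hv1 f lf fle.
  by have [h [lh hle hw _]] := amalgam_holds surjy hv; exists h.
have [t tE] : exists t : {linear A -> E}, t =1 v1 \o jw.
  apply: linear_pack => c x z; apply: dualE => f lf fle.
  have [h [lh _ hw]] := dual f lf fle.
  by rewrite /= lf !hw !hjw linearP lh.
have tw j : t (w j) = v1 j.
  rewrite tE; apply: dualE => f lf fle.
  by have [h [_ _ hw]] := dual f lf fle; rewrite /= !hw hjw.
have tle x : rnorm (t x) <= rnorm x.
  have [f [lf fle <-]] := norming_functional (t x) (seminorm_rnorm E).
  have [h [_ hle hw]] := dual f lf fle.
  by rewrite tE /= hw hjw -(into_isometry_rnorm x isoi).
have [T [Tle TE]] := injective_extension tle.
exists (T \o y); have -> : v1 = T \o i \o w.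
  by apply/funext => j; rewrite /= TE tw.
by apply: holds_amalgam => // c x z; rewrite linearP.
Qed.

End InjectiveExtension.

Lemma injective_one_complemented (a b : Type) (E : completeNormedModType K) :
    injective_space a b 1 E ->
  exists (U : completeNormedModType K) (Y : submodClosed U),
    [/\ universal_disposition a b U, one_complemented Y
      & isometric E (linear_subspace Y)].
Proof.
move=> injE.
pose J : Type := (nat * ((nat -> b) + (nat -> K)))%type.
pose iota n : J := (n, inr (fun=> 0)).
have iotaK : cancel iota fst by [].
have adl M : extendable E (limit_datum k iota M) by exact: banach_limit_datum.
pose sE := seminorm_rnorm E.
pose U : completeNormedModType K := uspace_banach iotaK sE adl.
have [base baseE] : exists base : {linear E -> U},
    base =1 fun x => uclass (@extendable R k E J) sE (Base J x).
  by apply: linear_pack => c x y; exact: uclass_Base.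
have baseN x : rnorm (base x) = rnorm x.
  by rewrite baseE; exact: rnorm_uclass_Base.
have [P [PE Ple]] : exists P : {linear U -> E},
    (forall x, P (base x) = x) /\ forall x, rnorm (P x) <= rnorm x.
  have [P [PE Ple]] := retraction E J; exists P; split=> // x.
  by rewrite baseE; exact: PE.
exists U, (range_submod base); split.
- move=> A B dA dB u i isou isoi.
  have [y hy] := dens_lt_surjection dB.
  (* An index names in [A] the [i]-preimage of the point that it names in [B], or 0 if there is
     none. *)
  pose w j := xget 0 [set x | i x = y j].
  have hw x : exists j, w j = x.
    have [j ij] := hy (i x); exists j; apply/eqP; rewrite -subr_eq0; apply/eqP.
    apply: rnorm0_eq0; rewrite -(into_isometry_rnorm _ isoi) linearB.
    have -> : i (w j) = y j by exact: (@xgetI _ 0 [set z | i z = y j] x (esym ij)).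
    by rewrite ij subrr rnorm0.
  have adm := extendable_amalgam injE dA dB isoi hw hy.
  exact: (@uspace_disposition R k J A B i w y isoi hw hy E _ _ sE adm u isou).
- have [Q QE] : exists Q : {linear U -> U}, Q =1 base \o P.
    by apply: linear_pack => c x y; rewrite /= !linearP.
  have Qle x : rnorm (Q x) <= rnorm x by rewrite QE /= baseN.
  have Qid x : x \in range_submod base -> Q x = x.
    by move=> /asboolP [z _ <-]; rewrite QE /= PE.
  split.
    move=> x /closureP_rnorm cx; apply/asboolP; exists (P x) => //.
    rewrite -[base _]/((base \o P) x) -QE; apply/eqP; rewrite -subr_eq0.
    apply/eqP; apply: rnorm0_eq0; apply: le_anti; rewrite rnorm_ge0 andbT.
    apply/ler_addgt0Pr => d d0; have d2 : 0 < d / 2 by lra.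
    have [y Yy xy] := cx _ d2.
    have := rnormBD (Q x) (Q y) x; rewrite -linearB (Qid y Yy) (rnormB y).
    have := Qle (x - y); lra.
  exists Q; split=> //; last by move=> x; rewrite QE; exact: mem_range_submod.
    by exists 1 => x; rewrite mul1r.
  by apply: opnorm_le => // x; rewrite mul1r.
- have [f fE] := corestrict (mem_range_submod base); exists f; split.
    by move=> x; rewrite -!rK_rnorm -rnorm_val fE baseN.
  move=> [y ry] _; have /asboolP [x _ xy] := ry; exists x => //.
  by apply: val_inj; rewrite fE.
Qed.

End InjectiveRetract.

(** * Extension of isometries to closures *)

Section ExtendIsometry.
Variables (R : realType) (k : scalar_kind).
Local Notation K := (scalars R k).
Local Notation nK := (@modulus R k).
Variable X : lmodType K.

Section ClosureRange.
Variables (V : normedModType K) (f : {linear X -> V}).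

Lemma closure_rangeP x : closure (range f) x <->
  forall e, 0 < e -> exists a, rnorm (x - f a) < e.
Proof.
split=> [/closureP_rnorm cx e /cx [_ [a _ <-] xa]|h]; first by exists a.
by apply/closureP_rnorm => e /h [a xa]; exists (f a) => //; exists a.
Qed.
End ClosureRange.

Section Graph.
Variables (V W : normedModType K) (f : {linear X -> V}) (g : {linear X -> W}).
Hypothesis fg : forall a, rnorm (g a) = rnorm (f a).

(** The closure in [V * W] of the pairs [(f a, g a)]; a relation avoids inverting [f], which may
    have a kernel. *)
Definition closed_graph (x : V) (z : W) :=
  forall e, 0 < e -> exists2 a, rnorm (x - f a) < e & rnorm (z - g a) < e.

Lemma closed_graph_lin c x x' z z' :
  closed_graph x z -> closed_graph x' z' ->
  closed_graph (c *: x + x') (c *: z + z').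
Proof.
move=> xz xz' e e0; have c0 : 0 < nK c + 1 by have := modulus_ge0 c; lra.
have e1 := divr_gt0 e0 c0.
have [a xa za] := xz _ e1; have [a' xa' za'] := xz' _ e1.
have bound (Y : normedModType K) (y y' : Y) :
    rnorm y < e / (nK c + 1) -> rnorm y' < e / (nK c + 1) ->
    rnorm (c *: y + y') < e.
  move=> ye ye'; apply: le_lt_trans (rnormD _ _) _; rewrite rnormZ.
  have -> : e = nK c * (e / (nK c + 1)) + e / (nK c + 1).
    by field; rewrite gt_eqF.
  by rewrite ler_ltD // ler_wpM2l ?modulus_ge0 // ltW.
by exists (c *: a + a'); rewrite linearP opprD addrACA -scalerBr; exact: bound.
Qed.

Lemma closed_graph_norm x z : closed_graph x z -> rnorm x = rnorm z.
Proof.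
move=> xz; suff h e : 0 < e -> rnorm x <= rnorm z + e /\ rnorm z <= rnorm x + e.
  by apply: le_anti; apply/andP; split; apply/ler_addgt0Pr => e /h [].
move=> e0; have e2 : 0 < e / 2 by lra.
have [a xa za] := xz _ e2; move: xa za (fg a).
have := rnormBD x (f a) 0; have := rnormBD z (g a) 0.
have := rnormBD (f a) x 0; have := rnormBD (g a) z 0.
rewrite !subr0 (rnormB (f a)) (rnormB (g a)) => h1 h2 h3 h4 h5 h6 h7.
split; lra.
Qed.

Lemma closed_graph_fun x z z' : closed_graph x z -> closed_graph x z' -> z = z'.
Proof.
move=> xz xz'; apply/eqP; rewrite -subr_eq0; apply/eqP; apply: rnorm0_eq0.
have := closed_graph_lin (-1) xz' xz; rewrite !scaleN1r addNr.
by move=> /closed_graph_norm; rewrite rnorm0 addrC.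
Qed.

Lemma closed_graph_refl a : closed_graph (f a) (g a).
Proof. by move=> e e0; exists a; rewrite subrr rnorm0. Qed.

End Graph.

Lemma closure_range_subspace (V : normedModType K) (f : {linear X -> V}) :
  subspace_axiom (closure (range f)).
Proof.
have gr x : closure (range f) x <-> closed_graph f f x x.
  split=> [/closure_rangeP cx e /cx [a xa]|cx]; first by exists a.
  by apply/closure_rangeP => e /cx [a xa _]; exists a.
split; first by apply/gr; have := closed_graph_refl f f 0; rewrite linear0.
by move=> c x y /gr gx /gr gy; apply/gr; exact: closed_graph_lin.
Qed.

Definition closure_submod (V : normedModType K) (f : {linear X -> V}) :
  submodClosed V := submod_of (closure_range_subspace f).

Lemma closed_closure_submod (V : normedModType K) (f : {linear X -> V}) :
  closed [set x | x \in closure_submod f].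
Proof.
rewrite (_ : mkset _ = closure (range f)); first exact: closed_closure.
by apply/seteqP; split=> x /asboolP.
Qed.

Lemma mem_closure_submod (V : normedModType K) (f : {linear X -> V}) a :
  f a \in closure_submod f.
Proof. by apply/asboolP/subset_closure; exists a. Qed.

(** The closed graph is linear and norm-preserving, hence single-valued; completeness of [W] makes
    it total on the closure of the range. *)
Lemma extend_isometry (V W : completeNormedModType K)
    (f : {linear X -> V}) (g : {linear X -> W}) :
    (forall a, rnorm (g a) = rnorm (f a)) ->
  exists i : {linear linear_subspace (closure_submod f) -> W},
    [/\ into_isometry i, forall z, closure (range g) (i z)
      & forall z a, val z = f a -> i z = g a].
Proof.
move=> fg.
have total (x : linear_subspace (closure_submod f)) :
    exists z, closed_graph f g (val x) z.
  case: x => x rx; have /asboolP/closure_rangeP cx := rx.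
  have /choice [a ha] : forall n, exists a, rnorm (x - f a) < rate R n.
    by move=> n; apply: cx; exact: rate_gt0.
  have [|n m|z hz] := @banach_limit R k W 1 (g \o a) => //.
    rewrite !mul1r /= -linearB fg linearB.
    apply: le_trans (rnormBD _ x _) _; rewrite (rnormB _ x).
    by rewrite lerD // ltW.
  exists z => e e0; have [N hN] := rate_lt e0; exists (a N).
    exact: lt_trans (ha N) (hN N (leqnn N)).
  rewrite rnormB; apply: le_lt_trans (hz N) _; rewrite mul1r.
  exact: hN.
have [j hj] := choice total.
have [i iE] : exists i : {linear linear_subspace (closure_submod f) -> W}, i =1 j.
  apply: linear_pack => c x y.
  apply: (closed_graph_fun fg (hj _)); rewrite linearP.
  by apply: closed_graph_lin; exact: hj.
exists i; split=> [x|x|x a xa]; rewrite iE.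
- rewrite -!rK_rnorm; congr scalar_of_real.
  by rewrite -rnorm_val; apply/esym; apply: (closed_graph_norm fg); exact: hj.
- by apply/closure_rangeP => e /(hj x) [a _ xa]; exists a.
- by apply: (closed_graph_fun fg (hj x)); rewrite xa; exact: closed_graph_refl.
Qed.

End ExtendIsometry.

(** * The pushout seminorm *)

Section Pushout.
Variables (R : realType) (k : scalar_kind).
Local Notation K := (scalars R k).
Local Notation nK := (@modulus R k).
Variables (A B E : normedModType K) (j : {linear A -> B}) (t : {linear A -> E}).
Variable c : R.
Hypothesis c0 : 0 <= c.
Hypothesis tc : forall x, rnorm (t x) <= c * rnorm (j x).

(* The norm that [B] receives from the pushout of [j] and [t], where [B] carries
   the norm [c * rnorm] for which [t] is a contraction. *)
Definition pushout_norm (b : B) : R :=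
  inf [set c * rnorm (b - j x) + rnorm (t x) | x in setT].

Lemma pushout_norm_le b x : pushout_norm b <= c * rnorm (b - j x) + rnorm (t x).
Proof.
apply: ge_inf; last by exists x.
by exists 0 => _ [y _ <-]; rewrite addr_ge0 ?mulr_ge0 ?rnorm_ge0.
Qed.

Lemma le_pushout_norm r b :
  (forall x, r <= c * rnorm (b - j x) + rnorm (t x)) -> r <= pushout_norm b.
Proof.
move=> h; apply: lb_le_inf => [|_ [x _ <-]]; last exact: h.
by exists (c * rnorm (b - j 0) + rnorm (t 0)), 0.
Qed.

Lemma pushout_norm_bound b : pushout_norm b <= c * rnorm b.
Proof. by have := pushout_norm_le b 0; rewrite !linear0 rnorm0 !addr0. Qed.

Lemma pushout_norm_left x : pushout_norm (j x) = rnorm (t x).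
Proof.
apply: le_anti; apply/andP; split.
  by have := pushout_norm_le (j x) x; rewrite subrr rnorm0 mulr0 add0r.
apply: le_pushout_norm => y; rewrite -linearB.
apply: le_trans (lerD (tc (x - y)) (lexx _)).
by rewrite linearB; have := rnormD (t x - t y) (t y); rewrite subrK.
Qed.

Lemma seminorm_pushout_norm : seminorm pushout_norm.
Proof.
apply: seminorm_of_le => [b b'||e b e0].
- rewrite -lerBlDr; apply: le_pushout_norm => x; rewrite lerBlDr -lerBlDl.
  apply: le_pushout_norm => y; rewrite lerBlDl.
  apply: le_trans (pushout_norm_le _ (x + y)) _.
  rewrite (linearD j) opprD addrACA (linearD t).
  have := ler_wpM2l c0 (rnormD (b - j x) (b' - j y)); rewrite mulrDr.
  have := rnormD (t x) (t y); lra.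
- by apply: le_trans (pushout_norm_bound _) _; rewrite rnorm0 mulr0.
- have ne := modulus_gt0 e0; rewrite mulrC -ler_pdivrMr //.
  apply: le_pushout_norm => x.
  rewrite ler_pdivrMr //; apply: le_trans (pushout_norm_le _ (e *: x)) _.
  rewrite (linearZ_LR j) (linearZ_LR t) -scalerBr !rnormZ.
  by rewrite le_eqVlt; apply/orP; left; apply/eqP; ring.
Qed.

End Pushout.

(** * From a complemented subspace to injectivity *)

Section ComplementedInjective.
Variables (R : realType) (k : scalar_kind).
Local Notation K := (scalars R k).

Lemma dens_lt_closure_submod (X V : normedModType K) (f : {linear X -> V}) M
    (c : Type) : (forall x, rnorm (f x) <= M * rnorm x) ->
  dens_lt X c -> dens_lt (linear_subspace (closure_submod f)) c.
Proof.
move=> fM; have [g gE] := corestrict (mem_closure_submod f).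
apply: (dens_lt_dense_range (f := g) (M := M)) => [x|[y ry] e e0].
  by rewrite -rnorm_val gE.
have /asboolP/closure_rangeP/(_ e e0) [x yx] := ry; exists x.
by rewrite -rnorm_val raddfB /= gE.
Qed.

(** With [nat] as index type and every problem admissible, the free construction is complete and has
    norm [rho] on its base. The image of [B] need not be dense in it; the closure of the range is
    taken afterwards. *)
Lemma seminormed_completion (B : lmodType K) (rho : B -> R) : seminorm rho ->
  exists (V : completeNormedModType K) (f : {linear B -> V}),
    forall x, rnorm (f x) = rho x.
Proof.
move=> sr.
have idK : cancel (id : nat -> nat) id by [].
pose V := uspace_banach idK (adm := fun=> True) sr (fun=> I).
have [f fE] : exists f : {linear B -> V},
    f =1 fun x => uclass (fun _ : datum R k nat => True) sr (Base nat x).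
  by apply: linear_pack => c x y; exact: uclass_Base.
by exists V, f => x; rewrite fE; exact: rnorm_uclass_Base.
Qed.

Lemma one_complemented_injective (a b : Type) (E U : completeNormedModType K)
    (Y : submodClosed U) :
    universal_disposition a b U -> one_complemented Y ->
    isometric E (linear_subspace Y) ->
  injective_space a b 1 E.
Proof.
move=> ud [_ [P [bP P1 PY Pid]]] [h [isoh surjh]] B A dB dA t bt.
(* Scaling the norm of [B] by [c], instead of normalising [t], covers [t = 0] as well. *)
pose c := opnorm t; have c0 : 0 <= c := opnorm_ge0 bt.
have tc x : rnorm (t x) <= c * rnorm (val x).
  by rewrite rnorm_val; exact: le_opnorm.
pose j : {linear linear_subspace A -> B} := val.
have srho := seminorm_pushout_norm j t c0.
have [V [f fE]] := seminormed_completion srho.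
have fjt x : rnorm ((f \o j) x) = rnorm (t x) by rewrite /= fE pushout_norm_left.
have fc x : rnorm (f x) <= c * rnorm x by rewrite fE pushout_norm_bound.
(* [i] extends [t x |-> f (j x)] to the closure of [t A]; equality of norms makes this well defined
   even if [t] has a kernel. *)
have [i [isoi ri iE]] := extend_isometry fjt.
have rif z : i z \in closure_submod f.
  apply/asboolP; apply: closure_subset (ri z) => _ [x _ <-].
  by exists (j x).
have [i' i'E] := corestrict rif.
have isoi' : into_isometry i'.
  by move=> z; apply: etrans (isoi z); rewrite -i'E.
pose u : {linear linear_subspace (closure_submod t) -> U} :=
  (val : linear_subspace Y -> U) \o h \o val.
have isou : into_isometry u by move=> z; exact: isoh.
have dA' := dens_lt_closure_submod (le_opnorm bt) dA.
have dB' := dens_lt_closure_submod fc dB.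
have [u' isou' uE] := ud (closed_subspace (@closed_closure_submod R k _ _ t))
  (closed_subspace (@closed_closure_submod R k _ _ f)) dA' dB' u i' isou isoi'.
have [fB fBE] := corestrict (mem_closure_submod f).
have [tA tAE] := corestrict (mem_closure_submod t).
(* [P] brings the values into [Y], a copy of [E], and keeps the bound [c] on [f]. *)
have [T0 T0E] := corestrict (f := P \o u' \o fB) (fun x => PY _).
have /choice [hinv hK] : forall y, exists x, h x = y.
  by move=> y; have [x _ hx] := surjh y I; exists x.
have [T TE] : exists T : {linear B -> E}, T =1 hinv \o T0.
  apply: linear_pack => d x y; apply: (into_isometry_inj isoh).
  by rewrite [RHS]linearP /= !hK linearP.
have Tle x : rnorm (T x) <= c * rnorm x.
  rewrite TE -(into_isometry_rnorm _ isoh) /= hK -rnorm_val T0E /=.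
  apply: le_trans (le_opnorm bP _) _.
  have uf : rnorm (u' (fB x)) = rnorm (f x).
    by rewrite -fBE rnorm_val; exact: into_isometry_rnorm.
  rewrite uf; apply: le_trans (fc x); rewrite -[leRHS]mul1r.
  by rewrite ler_wpM2r ?rnorm_ge0.
exists T; split=> [|x|]; first by exists c.
  apply: (into_isometry_inj isoh); apply: val_inj.
  rewrite TE /= hK T0E /=.
  (* On [A], [f x] is the image of [t x] under [i]; [u'] sends it into [Y], where [P] is the
     identity. *)
  have -> : fB (val x) = i' (tA x).
    by apply: val_inj; rewrite fBE i'E (iE _ x).
  have -> : u' (i' (tA x)) = val (h (t x)) by rewrite -[LHS]uE /= tAE.
  by rewrite Pid //; exact: valP.
by rewrite mul1r; exact: opnorm_le.
Qed.

End ComplementedInjective.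

Theorem theorem0p1 (R : realType) (k : scalar_kind) (a b : Type)
    (ha : infinite_set [set: a]) (hb : infinite_set [set: b])
    (hab : [set: a] #<= [set: b])
    (E : completeNormedModType (scalars R k)) :
  injective_space a b 1 E <->
  exists (U : completeNormedModType (scalars R k)) (Y : submodClosed U),
    [/\ universal_disposition a b U,
        one_complemented Y
      & isometric E (linear_subspace Y)].
Proof.
split; first exact: injective_one_complemented.
by case=> U [Y [ud cY iY]]; exact: one_complemented_injective ud cY iY.
Qed.
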